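(* Let $\tau_0,\tau_1>0$, $n\ge1$, $\lambda_i>0$ with $\sum_{i=1}^n\lambda_i=1$, $a_i>0$, $\mu_i=\mathcal N(m_i,\Sigma_i)\in\mathcal G_d^1$. For every initialization $\nu^0=\mathcal N(m^0,\Sigma^0)\in\mathcal G_d^1$, with iterates $\nu^{k+1}=T(\nu^k)=\mathcal N(m^{k+1},\Sigma^{k+1})$ of the moment update $T$ (see context), there exists $\underline\sigma_{\rm orb}>0$, depending on the data, penalties, and initialization, such that $$\Sigma^k\succeq\underline\sigma_{\rm orb}I\qquad(k\ge0).$$ More precisely, one may choose a constant $\underline p_{\rm orb}>0$ for which $$\lambda_{\min}(\Sigma^{k+1})\ge\min\{\lambda_{\min}(\Sigma^k),\underline p_{\rm orb}\}\qquad(k\ge0),$$ and therefore one may take $\underline\sigma_{\rm orb}=\min\{\lambda_{\min}(\Sigma^0),\underline p_{\rm orb}\}>0$.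
   Context: $\mathbb S_{++}^d$: real symmetric positive-definite $d\times d$ matrices; $\mathcal G_d^1=\{\mathcal N(m,\Sigma):m\in\mathbb R^d,\Sigma\in\mathbb S_{++}^d\}$; $\lambda_{\min}$ is the smallest eigenvalue. Put $s=\tau_0+\tau_1$, $\theta=\tau_0/s$. For $\mu,\nu\in\mathcal G_d^1$, $$\mathsf A(\mu,\nu)=\inf_{p,q\in\mathcal P(\mathbb R^d)}\{W_2^2(p,q)+\tau_0\mathrm{KL}(p\mid\mu)+\tau_1\mathrm{KL}(q\mid\nu)\},$$ with $\mathrm{KL}$ the relative entropy and $W_2^2(p,q)\in[0,\infty]$ the squared quadratic Wasserstein cost. It is known that the minimizer $(p,q)$ is unique and that $p,q$ are nondegenerate Gaussians. Set $A_i(\nu)=\mathsf A(\mu_i,\nu)$, let $q_i(\nu)=\mathcal N(v_i,Q_i)$ be the second component of the minimizer for $(\mu_i,\nu)$, and $$\omega_i(\nu)=\frac{\lambda_ia_i^\theta e^{-A_i(\nu)/s}}{\sum_j\lambda_ja_j^\theta e^{-A_j(\nu)/s}}.$$ The moment update is $T(\nu)=\mathcal N(m^+,\Sigma^+)$ with $m^+=\sum_i\omega_i(\nu)v_i$ and $\Sigma^+=\sum_i\omega_i(\nu)[Q_i+(v_i-m^+)(v_i-m^+)^\top]$. *)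

(* Defs.v *)
From HB Require Import structures.
From mathcomp Require Import all_boot all_order all_algebra.
From mathcomp Require Import all_classical all_reals all_analysis.

Set Implicit Arguments.
Unset Strict Implicit.
Unset Printing Implicit Defensive.

Import Order.TTheory GRing.Theory Num.Theory.
Import numFieldNormedType.Exports.

Local Open Scope classical_set_scope.
Local Open Scope ring_scope.

(* R^d as a measurable space: the sigma-algebra on tuples is generated by the
   coordinates, hence is the Borel one.  Linear algebra takes place in
   ['cV[R]_d], to which points are sent by [vec] below. *)
Notation Rspace R d := (d.-tuple (measurableTypeR R)).

Section LebesgueTuple.
Variable R : realType.

Definition tcons (d : nat) (x : measurableTypeR R * Rspace R d) :
  Rspace R d.+1 := [tuple of x.1 :: x.2].

Lemma measurable_tcons d : measurable_fun setT (@tcons d).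
Proof.
by apply: measurable_cons; [exact: measurable_fst|exact: measurable_snd].
Qed.

Section lebesgue_cons.
Variables (d : nat) (m : {sigma_finite_measure set (Rspace R d) -> \bar R}).

Definition lebesgue_cons : set (Rspace R d.+1) -> \bar R :=
  pushforward (lebesgue_measure \x m)%E (@tcons d).

Let mtcons := @measurable_tcons d.

Let lebesgue_cons0 : lebesgue_cons set0 = 0%E.
Proof. exact: measure0. Qed.

Let lebesgue_cons_ge0 A : (0 <= lebesgue_cons A)%E.
Proof. exact: measure_ge0. Qed.

Let lebesgue_cons_sigma_additive : semi_sigma_additive lebesgue_cons.
Proof. exact: measure_semi_sigma_additive. Qed.

HB.instance Definition _ := isMeasure.Build _ _ _ lebesgue_cons
  lebesgue_cons0 lebesgue_cons_ge0 lebesgue_cons_sigma_additive.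

Let lebesgue_cons_sigma_finite : sigma_finite setT lebesgue_cons.
Proof.
pose uncons (t : Rspace R d.+1) : measurableTypeR R * Rspace R d :=
  (thead t, [tuple of behead t]).
have unconsK : cancel (@tcons d) uncons.
  by move=> [x t]; congr pair => //; apply: val_inj.
have muncons : measurable_fun setT uncons.
  by apply/measurable_fun_pairP; split;
    [exact: measurable_tnth|exact: measurable_behead].
have /sigma_finiteP[F [TF ndF Foo]] := sigma_finiteT (@lebesgue_measure R).
have /sigma_finiteP[G [TG ndG Goo]] := sigma_finiteT m.
exists (fun k => uncons @^-1` (F k `*` G k)).
  rewrite -preimage_bigcup; apply/esym; rewrite -subTset => t _.
  have [i _ Fi] : (\bigcup_i F i) (thead t) by rewrite -TF.
  have [j _ Gj] : (\bigcup_i G i) [tuple of behead t] by rewrite -TG.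
  exists (maxn i j) => //; split => /=.
    by move: Fi; apply/subsetPset/ndF/leq_maxl.
  by move: Gj; apply/subsetPset/ndG/leq_maxr.
move=> k; have [mF Fk] := Foo k; have [mG Gk] := Goo k; split.
  by rewrite -[X in measurable X]setTI; apply: muncons => //; exact: measurableX.
rewrite /lebesgue_cons /pushforward.
have -> : @tcons d @^-1` (uncons @^-1` (F k `*` G k)) = F k `*` G k.
  by apply/seteqP; split => x; rewrite /preimage /mkset unconsK.
by rewrite product_measure1E// lte_mul_pinfty// ge0_fin_numE.
Qed.

HB.instance Definition _ := Measure_isSigmaFinite.Build _ _ _
  lebesgue_cons lebesgue_cons_sigma_finite.

End lebesgue_cons.

(* Lebesgue measure on R^d, as a d-fold product. *)
Fixpoint lebesgue_tuple (d : nat) :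
    {sigma_finite_measure set (Rspace R d) -> \bar R} :=
  match d with
  | 0 => \d_ ([tuple] : Rspace R 0)
  | d'.+1 => lebesgue_cons (lebesgue_tuple d')
  end.

End LebesgueTuple.

Section LinearAlgebra.
Variables (R : realType) (d : nat).
Implicit Types (A B : 'M[R]_d) (x : 'cV[R]_d).

Definition vec (t : Rspace R d) : 'cV[R]_d := \col_i tnth t i.

Definition qform A x : R := (x^T *m A *m x) 0 0.

Definition posdefmx A : Prop :=
  A \is symmetricmx /\ forall x, x != 0 -> 0 < qform A x.

Definition psdmx A : Prop :=
  A \is symmetricmx /\ forall x, 0 <= qform A x.

Definition loewner_le A B : Prop := psdmx (B - A).

(* For a symmetric matrix of positive size the infimum is a minimum: the set is
   finite and nonempty. *)
Definition lambda_min A : R := inf [set a | eigenvalue A a].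

End LinearAlgebra.

Section Gaussian.
Variables (R : realType) (d : nat).
Local Notation E := (Rspace R d).

Definition gaussian_pdf (m : 'cV[R]_d) (S : 'M[R]_d) (t : E) : R :=
  (Num.sqrt ((2 * pi) ^+ d * \det S))^-1 *
  expR (- (qform (invmx S) (vec t - m) / 2)).

(* P = N(m, S); only meaningful for positive definite S. *)
Definition gaussian_law (P : probability E R) (m : 'cV[R]_d) (S : 'M[R]_d) :=
  forall A : set E, measurable A ->
    P A = (\int[@lebesgue_tuple R d]_(t in A) (gaussian_pdf m S t)%:E)%E.

Definition nondegenerate_gaussian P m S : Prop :=
  posdefmx S /\ gaussian_law P m S.

End Gaussian.

Section Functionals.
Variables (R : realType) (d : nat).
Local Notation E := (Rspace R d).
Local Open Scope ereal_scope.
Implicit Types p q mu nu : probability E R.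

(* The value of ln at 0 is irrelevant, as {dp/dmu = 0} is p-null. *)
Definition KL p mu : \bar R :=
  if `[< p `<< mu >]
  then \int[p]_t
    (ln (fine (Radon_Nikodym (charge_of_finite_measure p) mu t)))%:E
  else +oo.

Definition coupling p q (g : probability (E * E)%type R) : Prop :=
  forall A : set E, measurable A ->
    g (fst @^-1` A) = p A /\ g (snd @^-1` A) = q A.

Definition sqdist (t : E * E) : R :=
  (\sum_(i < d) (tnth t.1 i - tnth t.2 i) ^+ 2)%R.

Definition W2sq p q : \bar R :=
  ereal_inf [set \int[g]_t (sqdist t)%:E | g in coupling p q].

Definition objective (tau0 tau1 : R) mu nu p q : \bar R :=
  W2sq p q + tau0%:E * KL p mu + tau1%:E * KL q nu.

Definition Acost (tau0 tau1 : R) mu nu : \bar R :=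
  ereal_inf [set objective tau0 tau1 mu nu p q | p in setT & q in setT].

Definition minimizer (tau0 tau1 : R) mu nu p q : Prop :=
  objective tau0 tau1 mu nu p q = Acost tau0 tau1 mu nu.

End Functionals.

Section MomentUpdate.
Variables (R : realType) (d n : nat) (tau0 tau1 : R) (lam a : 'I_n -> R).
Variable mu : 'I_n -> probability (Rspace R d) R.

(* [Acost] is finite between Gaussians. *)
Definition weight (nu : probability (Rspace R d) R) (i : 'I_n) : R :=
  let s := tau0 + tau1 in
  let w j := lam j * a j `^ (tau0 / s) *
             expR (- (fine (Acost tau0 tau1 (mu j) nu) / s)) in
  w i / \sum_j w j.

(* T(nu) = N(m', S'), as the graph of T: the minimizers (p_i, q_i) are unique
   and are pairs of nondegenerate Gaussians, so this determines (m', S'). *)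
Definition moment_update (nu : probability (Rspace R d) R)
    (m' : 'cV[R]_d) (S' : 'M[R]_d) : Prop :=
  exists (p q : 'I_n -> probability (Rspace R d) R)
    (u v : 'I_n -> 'cV[R]_d) (P Q : 'I_n -> 'M[R]_d),
  [/\ forall i, minimizer tau0 tau1 (mu i) nu (p i) (q i),
      forall i, nondegenerate_gaussian (p i) (u i) (P i),
      forall i, nondegenerate_gaussian (q i) (v i) (Q i),
      m' = \sum_i weight nu i *: v i
    & S' = \sum_i weight nu i *:
             (Q i + (v i - m') *m (v i - m')^T)].

(* nu^k = N(m^k, S^k) with nu^0 = N(m0, S0) and nu^(k+1) = T(nu^k). *)
Definition moment_orbit (m0 : 'cV[R]_d) (S0 : 'M[R]_d)
    (nu : nat -> probability (Rspace R d) R)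
    (m : nat -> 'cV[R]_d) (S : nat -> 'M[R]_d) : Prop :=
  [/\ m 0%N = m0, S 0%N = S0,
      forall k, gaussian_law (nu k) (m k) (S k)
    & forall k, moment_update (nu k) (m k.+1) (S k.+1)].

End MomentUpdate.

(* Main.v *)
Require Import Defs.
From HB Require Import structures.
From mathcomp Require Import all_boot all_order all_algebra.
From mathcomp Require Import all_classical all_reals all_analysis.
From mathcomp Require Import measurable_realfun complex ring lra.

Import Order.TTheory GRing.Theory Num.Theory.
Import numFieldNormedType.Exports.

Local Open Scope classical_set_scope.
Local Open Scope ring_scope.

Set Implicit Arguments.
Unset Strict Implicit.
Unset Printing Implicit Defensive.

(* Let (p, q) = (N(u, P), N(v, Q)) minimize the objective for mu = N(m0, S0)
   and nu = N(m, S), and let M be the positive definite matrix with M P M = Q.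
   Stretching q by 1 + t along a unit eigenvector x of Q, Q x = a x, and moving
   the coupling along the map M, a first variation at t = 0+ gives
     0 <= 2 a (1 - x.M^-1 x) + tau1 (a x.S^-1 x - 1).
   The same variation of p yields P >= c := (1 / lambda_min S0 + 2 / tau0)^-1.
   If a were below min(lambda_min S, c), the displayed inequality would force
   x.M^-1 x < 1, whereas P >= c and the operator monotonicity of the square root
   give a x.M^-1 x >= sqrt (c a) > a.  Hence
   lambda_min Q >= min(lambda_min S, c); a mixture only adds the positive
   semidefinite dispersion of its means, so the bound passes to the moment
   update.  The transport cost is needed only through a lower bound by quadratic
   Kantorovich potentials and an upper bound by explicit linear couplings. *)

(** * Real symmetric matrices *)

Section SymmetricMatrices.
Variables (R : realType).

Lemma symmetricmxP n (A : 'M[R]_n) : reflect (A^T = A) (A \is symmetricmx).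
Proof.
by apply: (iffP (is_hermitianmxP _ _ _)); rewrite expr0 scale1r map_mx_id.
Qed.

Definition dot n (x y : 'cV[R]_n) : R := (x^T *m y) 0 0.

Lemma dotC n (x y : 'cV[R]_n) : dot x y = dot y x.
Proof. by rewrite /dot -[in LHS](trmxK y) -trmx_mul mxE. Qed.

Lemma dotE n (x y : 'cV[R]_n) : dot x y = \sum_i x i 0 * y i 0.
Proof. by rewrite /dot mxE; apply: eq_bigr => i _; rewrite mxE. Qed.

Lemma dot_ge0 n (x : 'cV[R]_n) : 0 <= dot x x.
Proof. by rewrite dotE sumr_ge0// => i _; rewrite -expr2 sqr_ge0. Qed.

Lemma dot_eq0 n (x : 'cV[R]_n) : (dot x x == 0) = (x == 0).
Proof.
apply/idP/eqP => [|->]; last by rewrite /dot mulmx0 mxE.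
rewrite dotE psumr_eq0 => [/allP x0|i _]; last by rewrite -expr2 sqr_ge0.
apply/colP => i; rewrite mxE; have := x0 i (mem_index_enum _).
by rewrite -expr2 sqrf_eq0 => /eqP.
Qed.

Lemma dot_gt0 n (x : 'cV[R]_n) : (0 < dot x x) = (x != 0).
Proof. by rewrite lt_def dot_ge0 dot_eq0 andbT. Qed.

Lemma dotDl n (x y z : 'cV[R]_n) : dot (x + y) z = dot x z + dot y z.
Proof. by rewrite /dot linearD mulmxDl mxE. Qed.

Lemma dotDr n (x y z : 'cV[R]_n) : dot z (x + y) = dot z x + dot z y.
Proof. by rewrite dotC dotDl !(dotC z). Qed.

Lemma dotZl n a (x z : 'cV[R]_n) : dot (a *: x) z = a * dot x z.
Proof. by rewrite /dot linearZ -scalemxAl mxE. Qed.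

Lemma dotZr n a (x z : 'cV[R]_n) : dot z (a *: x) = a * dot z x.
Proof. by rewrite dotC dotZl dotC. Qed.

Lemma dotNl n (x z : 'cV[R]_n) : dot (- x) z = - dot x z.
Proof. by rewrite -scaleN1r dotZl mulN1r. Qed.

Lemma dotNr n (x z : 'cV[R]_n) : dot z (- x) = - dot z x.
Proof. by rewrite dotC dotNl dotC. Qed.

Lemma dotMl n m (A : 'M[R]_(m, n)) x y : dot (A *m x) y = dot x (A^T *m y).
Proof. by rewrite /dot trmx_mul mulmxA. Qed.

Lemma dotMr n m (A : 'M[R]_(m, n)) x y : dot x (A *m y) = dot (A^T *m x) y.
Proof. by rewrite dotMl trmxK. Qed.

Lemma qformE n (A : 'M[R]_n) x : qform A x = dot x (A *m x).
Proof. by rewrite /qform /dot mulmxA. Qed.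

Lemma mul_dot n (x y : 'cV[R]_n) : x^T *m y = (dot x y)%:M.
Proof. exact: mx11_scalar. Qed.

Lemma outer_mul n (x y z : 'cV[R]_n) : (x *m y^T) *m z = dot y z *: x.
Proof. by rewrite -mulmxA mul_dot mul_mx_scalar. Qed.

(** The complexification of [A] is Hermitian, so the complex spectral theorem gives it a real
    eigenvalue, and eigenvalues descend along the field embedding. *)
Lemma symmetric_eigenvalue n (A : 'M[R]_n.+1) :
  A^T = A -> exists a, eigenvalue A a.
Proof.
move=> symA; pose f := real_complex R; pose B := map_mx f A.
have realB : B \is a realmx.
  apply/mxOverP => i j; rewrite mxE; apply/Creal_ImP.
  by rewrite -complexIm.
have symB : B \is symmetricmx.
  by apply/is_hermitianmxP; rewrite expr0 scale1r map_mx_id // /B map_trmx symA.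
have hermB := realsym_hermsym symB realB.
have /hermitian_normalmx/orthomx_spectralP BE := hermB.
have /mxOverP/(_ 0 0) := hermitian_spectral_diag_real hermB.
move: BE; set P := spectralmx B; set D := spectral_diag B => BE realD.
have uP : P \in unitmx by exact: spectral_unit.
have [a Da] : exists a : R, D 0 0 = f a.
  exists (complex.Re (D 0 0)).
  by rewrite -[LHS](Creal_ReP _ realD) -complexRe.
exists a; suff: eigenvalue B (D 0 0).
  by rewrite Da (eigenvalue_map (real_complex R : {rmorphism _ -> _})).
apply/eigenvalueP.
exists (row 0 P); last first.
  apply/eqP => P0; have := row_unitarymxP (spectral_unitarymx B).
  move=> /(_ 0 0); rewrite -/P P0 eqxx; rewrite linear0l => /eqP.
  by rewrite eq_sym oner_eq0.
rewrite [in LHS]BE -row_mul !mulmxA mulmxV// mul1mx.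
by rewrite row_mul row_diag_mx -scalemxAl -rowE.
Qed.

(** The reflection in the hyperplane orthogonal to [x - y] exchanges two vectors of equal norm. *)
Lemma householder n (x y : 'cV[R]_n) : dot x x = dot y y ->
  exists O : 'M[R]_n, [/\ O^T = O, O *m O = 1%:M & O *m y = x].
Proof.
move=> xy; have [->|neq_xy] := eqVneq x y.
  by exists 1%:M; rewrite trmx1 !mul1mx.
pose w := x - y; pose c := 2 / dot w w.
have w0 : dot w w != 0 by rewrite dot_eq0 subr_eq0.
pose W := w *m w^T.
have WT : W^T = W by rewrite trmx_mul trmxK.
have WW : W *m W = dot w w *: W by rewrite mulmxA outer_mul -scalemxAl.
exists (1%:M - c *: W); split.
- by rewrite linearB linearZ /= trmx1 WT.
- rewrite mulmxBl !mulmxBr !mul1mx mulmx1 -!scalemxAl -!scalemxAr WW !scalerA.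
  rewrite [c * c * _](_ : _ = c + c); last first.
    by rewrite /c mulrAC divfK// mulrDl mul1r.
  by rewrite scalerDl opprB addrK subrK.
- rewrite mulmxBl mul1mx -scalemxAl outer_mul scalerA.
  have wwE : dot w w = - (2 * dot w y).
    rewrite /w !dotDl !dotDr !dotNl !dotNr xy (dotC y x).
    ring.
  have -> : c * dot w y = - 1.
    by rewrite /c mulrAC -[2 * _]opprK -wwE mulNr mulfV.
  by rewrite scaleN1r opprK addrC subrK.
Qed.

(** Induction on the size: a reflection carries a unit eigenvector to the first basis vector,
    symmetry then makes the conjugated matrix block diagonal, and the lower block is diagonalized by
    induction. *)
Lemma symmetric_spectral n (A : 'M[R]_n) : A^T = A ->
  exists (O : 'M[R]_n) (D : 'rV[R]_n),
    O *m O^T = 1%:M /\ A = O^T *m diag_mx D *m O.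
Proof.
elim: n A => [|n IHn].
  by move=> A _; exists 1%:M, 0; split; rewrite !flatmx0.
rewrite -[n.+1]/(1 + n)%N => A symA.
have [a [v vA v0]] : exists a, exists2 v : 'rV[R]_(1 + n),
    v *m A = a *: v & v != 0.
  by have [a /eigenvalueP[v vA v0]] := @symmetric_eigenvalue n A symA;
    exists a, v.
have Av : A *m v^T = a *: v^T by rewrite -[in LHS]symA -trmx_mul vA linearZ.
have vv0 : 0 < dot v^T v^T by rewrite dot_gt0 trmx_eq0.
pose x : 'cV[R]_(1 + n) := (Num.sqrt (dot v^T v^T))^-1 *: v^T.
have xx : dot x x = 1.
  rewrite dotZl dotZr mulrA -invfM -expr2 sqr_sqrtr ?mulVf ?(ltW vv0)//.
  by rewrite gt_eqF.
have Ax : A *m x = a *: x by rewrite -scalemxAr Av !scalerA mulrC.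
pose e : 'cV[R]_(1 + n) := col_mx 1%:M 0.
have ee : dot e e = 1.
  by rewrite /dot tr_col_mx mul_row_col trmx1 mul1mx mulmx0 addr0 mxE.
have [|O [OT OO Oe]] := @householder (1 + n) x e; first by rewrite xx ee.
pose B : 'M[R]_(1 + n) := O *m A *m O.
have BT : B^T = B by rewrite /B !trmx_mul OT symA mulmxA.
have Be : B *m e = a *: e.
  by rewrite /B -mulmxA Oe -mulmxA Ax -scalemxAr -Oe mulmxA OO mul1mx.
(* The eigenvector equation fixes the first column of [B]; symmetry copies its zeros to the first
   row. *)
have BE : B = block_mx a%:M 0 0 (drsubmx B).
  have := Be; rewrite -{1}[B]submxK mul_block_col !mulmx0 !addr0 !mulmx1.
  rewrite scale_col_mx scaler0 => /eq_col_mx[ulB dlB].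
  rewrite -{1}[B]submxK ulB dlB -[ursubmx B]trmxK trmx_ursub BT dlB trmx0.
  by congr block_mx; rewrite scalemx1.
have [|O1 [D [orthO1 drE]]] := IHn (drsubmx B).
  by rewrite trmx_drsub BT.
pose U : 'M[R]_(1 + n) := block_mx 1%:M 0 0 O1.
exists (U *m O), (row_mx a%:M D : 'rV_(1 + n)); split.
  rewrite trmx_mul OT mulmxA -(mulmxA U) OO mulmx1 /U tr_block_mx !trmx0 trmx1.
  rewrite mulmx_block !mul0mx !mulmx0 !addr0 !add0r mulmx1 orthO1.
  by rewrite -scalar_mx_block.
have -> : A = O *m B *m O.
  by rewrite /B !mulmxA OO mul1mx -mulmxA OO mulmx1.
clearbody B.
rewrite trmx_mul OT !mulmxA; congr (_ *m _); rewrite -!mulmxA; congr (_ *m _).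
rewrite BE drE diag_mx_row /U tr_block_mx !trmx0 trmx1 !mulmx_block.
rewrite !mul0mx !mulmx0 !mul1mx !addr0 !add0r ?mul0mx !mulmx1 mulmxA mulmx0.
by congr block_mx; apply/matrixP => i j; rewrite !mxE !ord1.
Qed.

End SymmetricMatrices.

(** * Rayleigh bounds, square roots and transport matrices for positive definite matrices *)

Section PositiveDefinite.
Variable R : realType.

Lemma lambda_minE n (A : 'M[R]_n) a (x : 'cV[R]_n) : A^T = A -> x != 0 ->
  A *m x = a *: x -> (forall y : 'cV_n, a * dot y y <= qform A y) ->
  lambda_min A = a.
Proof.
move=> symA x0 Ax Aa.
have eigA b : eigenvalue A b -> a <= b.
  case/eigenvalueP => v vA v0.
  have v'0 : v^T != 0 by rewrite trmx_eq0.
  have := Aa v^T; rewrite qformE -[in A *m _]symA -trmx_mul vA linearZ dotZr.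
  by rewrite ler_pM2r// dot_gt0.
have eiga : eigenvalue A a.
  apply/eigenvalueP; exists x^T; last by rewrite trmx_eq0.
  by rewrite -[in LHS]symA -trmx_mul Ax linearZ.
apply/eqP; rewrite eq_le; apply/andP; split.
- by apply: ge_inf => //; exists a => b; exact: eigA.
- by apply: lb_le_inf; [exists a|move=> b; exact: eigA].
Qed.

(** The Rayleigh principle, read off the smallest diagonal entry of a spectral decomposition. All
    later facts on [lambda_min] go through this unit eigenvector and this lower bound. *)
Lemma lambda_min_spec n (A : 'M[R]_n) : (0 < n)%N -> A^T = A ->
  exists x, [/\ dot x x = 1, A *m x = lambda_min A *: x
    & forall y, lambda_min A * dot y y <= qform A y].
Proof.
case: n A => // n A _ symA.
have [U [D [UU AE]]] := symmetric_spectral symA.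
have UTU := mulmx1C UU.
pose i := [arg min_(i < (ord0 : 'I_n.+1)) D 0 i]%O.
have Di j : D 0 i <= D 0 j.
  by rewrite /i; case: arg_minP => // k _ ->.
pose x := U^T *m (delta_mx i 0 : 'cV[R]_n.+1).
have xx : dot x x = 1.
  rewrite dotMl trmxK /x mulmxA UU mul1mx dotE (bigD1 i)//= big1 ?addr0.
    by rewrite mxE !eqxx mulr1.
  by move=> j /negPf ji; rewrite mxE ji mul0r.
have Ax : A *m x = D 0 i *: x.
  rewrite AE /x -!mulmxA (mulmxA U) UU mul1mx scalemxAr; congr (_ *m _).
  apply/colP => j; rewrite mul_diag_mx !mxE.
  by have [->|] := eqVneq j i; rewrite ?mulr0.
have Ay y : D 0 i * dot y y <= qform A y.
  have -> : dot y y = dot (U *m y) (U *m y).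
    by rewrite [RHS]dotMl mulmxA UTU mul1mx.
  rewrite qformE AE -!mulmxA (dotMr U^T) trmxK mul_diag_mx !dotE mulr_sumr.
  apply: ler_sum => j _; rewrite [X in _ <= _ * X]mxE [leRHS]mulrCA ler_wpM2r//.
  by rewrite -expr2 sqr_ge0.
have x0 : x != 0 by rewrite -dot_gt0 xx.
by exists x; rewrite (lambda_minE symA x0 Ax Ay).
Qed.

Lemma lambda_min_ge n (A : 'M[R]_n) a : (0 < n)%N -> A^T = A ->
  (forall x : 'cV_n, dot x x = 1 -> a <= qform A x) -> a <= lambda_min A.
Proof.
move=> n0 symA Aa; have [x [xx Ax _]] := lambda_min_spec n0 symA.
by have := Aa x xx; rewrite qformE Ax dotZr xx mulr1.
Qed.

Lemma posdefmx_sym n (A : 'M[R]_n) : posdefmx A -> A^T = A.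
Proof. by case=> /symmetricmxP. Qed.

Lemma posdefmx_unit n (A : 'M[R]_n) : posdefmx A -> A \in unitmx.
Proof.
move=> pA; rewrite unitmxE unitfE; apply/negP => /det0P[v v0 vA].
have := pA.2 v^T; rewrite qformE -[in A *m _](posdefmx_sym pA) -trmx_mul vA.
by rewrite trmx_eq0 trmx0 /dot mulmx0 mxE ltxx => /(_ v0).
Qed.

Lemma lambda_min_gt0 n (A : 'M[R]_n) : (0 < n)%N -> posdefmx A ->
  0 < lambda_min A.
Proof.
move=> n0 pA; have [x [xx Ax _]] := lambda_min_spec n0 (posdefmx_sym pA).
have := pA.2 x; rewrite qformE Ax dotZr xx mulr1; apply.
by rewrite -dot_gt0 xx.
Qed.

Lemma qform_conj n m (A : 'M[R]_n) (L : 'M[R]_(n, m)) x :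
  qform (L^T *m A *m L) x = qform A (L *m x).
Proof. by rewrite !qformE -!mulmxA dotMr trmxK. Qed.

Lemma posdefmx_conj n (A L : 'M[R]_n) : posdefmx A -> L \in unitmx ->
  posdefmx (L^T *m A *m L).
Proof.
move=> pA uL; split=> [|x x0].
  by apply/symmetricmxP; rewrite !trmx_mul trmxK (posdefmx_sym pA) mulmxA.
rewrite qform_conj; apply: pA.2; apply: contraNneq x0 => Lx.
by rewrite -[x](mulKmx uL) Lx mulmx0.
Qed.

Lemma posdefmx_inv n (A : 'M[R]_n) : posdefmx A -> posdefmx (invmx A).
Proof.
move=> pA; have uA := posdefmx_unit pA.
have := @posdefmx_conj _ A (invmx A) pA; rewrite unitmx_inv => /(_ uA).
by rewrite trmx_inv (posdefmx_sym pA) mulVmx// mul1mx.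
Qed.

Lemma posdefmx_sqrt n (A : 'M[R]_n) : posdefmx A ->
  exists2 B, posdefmx B & B *m B = A.
Proof.
move=> pA; have [U [D [UU AE]]] := symmetric_spectral (posdefmx_sym pA).
have uU : U \in unitmx by case/mulmx1_unit: UU.
have D0 i : 0 < D 0 i.
  (* The quadratic form at the [i]-th eigenvector equals [D 0 i]. *)
  have := pA.2 (U^T *m delta_mx i 0).
  rewrite AE -qform_conj trmxK !mulmxA UU mul1mx -mulmxA UU mulmx1.
  rewrite qformE mul_diag_mx dotE (bigD1 i)//= big1 ?addr0; last first.
    by move=> j /negPf ji; rewrite !mxE ji mul0r.
  rewrite !mxE !eqxx mulr1 mul1r; apply.
  apply/eqP => /(congr1 (mulmx U)); rewrite mulmxA UU mul1mx mulmx0.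
  by move=> /matrixP/(_ i 0); rewrite !mxE !eqxx => /eqP; rewrite oner_eq0.
exists (U^T *m diag_mx (map_mx Num.sqrt D) *m U); last first.
  rewrite -!mulmxA (mulmxA U) UU mul1mx (mulmxA (diag_mx _)) mulmx_diag AE.
  rewrite -!mulmxA; congr (_ *m (diag_mx _ *m _)); apply/rowP => i.
  by rewrite !mxE -expr2 sqr_sqrtr// ltW.
apply: posdefmx_conj => //; split=> [|x x0].
  by apply/symmetricmxP; rewrite tr_diag_mx.
have sD i : 0 < Num.sqrt (D 0 i) by rewrite sqrtr_gt0.
rewrite qformE mul_diag_mx dotE lt_def psumr_neq0; last first.
  move=> i _; rewrite !mxE mulrCA mulr_ge0// ?(ltW (sD _))//.
  by rewrite -expr2 sqr_ge0.
rewrite sumr_ge0 ?andbT; last first.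
  move=> i _; rewrite !mxE mulrCA mulr_ge0// ?(ltW (sD _))//.
  by rewrite -expr2 sqr_ge0.
have [i xi] : exists i, x i 0 != 0.
  by move: x0 => /cV0Pn[i xi]; exists i.
apply/hasP; exists i; first exact: mem_index_enum.
by rewrite /= !mxE mulrCA mulr_gt0// -expr2 exprn_even_gt0.
Qed.

Lemma posdefmx_det n (A : 'M[R]_n) : posdefmx A -> 0 < \det A.
Proof.
move=> pA; have [B _ AE] := posdefmx_sqrt pA.
have := posdefmx_unit pA; rewrite -AE unitmxE unitfE det_mulmx mulf_eq0 orbb.
by move=> B0; rewrite -expr2 exprn_even_gt0.
Qed.

Lemma posdefmx_qform_ge0 n (A : 'M[R]_n) x : posdefmx A -> 0 <= qform A x.
Proof.
move=> pA; have [->|x0] := eqVneq x 0; first by rewrite /qform mulmx0 mxE.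
exact/ltW/pA.2.
Qed.

(** Otherwise [B *m x - Num.sqrt a *: x] would be an eigenvector of [B] with eigenvalue
    [- Num.sqrt a], against positive definiteness. *)
Lemma posdefmx_sqrt_eigen n (B : 'M[R]_n) a (x : 'cV[R]_n) :
  posdefmx B -> 0 <= a ->
  B *m (B *m x) = a *: x -> B *m x = Num.sqrt a *: x.
Proof.
move=> pB a0 BBx; apply/eqP; rewrite -subr_eq0; apply/eqP.
set y := _ - _; apply/eqP; apply: contraT => y0.
have By : B *m y = - (Num.sqrt a *: y).
  rewrite /y mulmxBr BBx -scalemxAr scalerBr opprB scalerA -expr2.
  by rewrite sqr_sqrtr.
have := pB.2 y y0; rewrite qformE By dotNr dotZr oppr_gt0 ltNge.
by rewrite mulr_ge0// ?sqrtr_ge0// dot_ge0.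
Qed.

(* Operator monotonicity of the square root: on a unit eigenvector y of K - B
   with eigenvalue e, B y = K y - e y, so |B y| <= |K y| forces e >= 0. *)
Lemma qform_le_of_norm_le n (K B : 'M[R]_n) : posdefmx K -> B^T = B ->
  (forall y : 'cV_n, dot (B *m y) (B *m y) <= dot (K *m y) (K *m y)) ->
  forall y, qform B y <= qform K y.
Proof.
case: n K B => [|n] K B pK symB BK y.
  by rewrite [y]flatmx0 /qform !mulmx0.
have symKB : (K - B)^T = K - B by rewrite linearB /= symB (posdefmx_sym pK).
have [x [xx KBx KBge]] := lambda_min_spec (ltn0Sn n) symKB.
set e := lambda_min (K - B) in KBx KBge.
have e0 : 0 <= e.
  rewrite leNgt; apply/negP => e0.
  have Bx : B *m x = K *m x - e *: x.
    by rewrite -KBx mulmxBl opprB addrC subrK.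
  have := BK x; rewrite Bx !dotDl !dotDr !dotNl !dotNr !dotZl !dotZr xx mulr1.
  rewrite (dotC (K *m x) x) -qformE.
  have := posdefmx_qform_ge0 x pK; nra.
have := KBge y; rewrite !qformE mulmxBl dotDr dotNr => KBy.
by rewrite -subr_ge0 (le_trans _ KBy)// mulr_ge0// dot_ge0.
Qed.

(* M is the geometric mean of Q and the inverse of P, i.e. the linear part of
   the optimal transport map from N(u, P) to N(v, Q). *)
Lemma transport_matrix n (P Q : 'M[R]_n) : posdefmx P -> posdefmx Q ->
  exists M : 'M[R]_n, [/\ posdefmx M, M *m P *m M = Q
    & forall c a (x : 'cV[R]_n), 0 <= c -> 0 < a ->
        (forall y : 'cV_n, c * dot y y <= qform P y) ->
        Q *m x = a *: x -> dot x x = 1 ->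
        Num.sqrt c * Num.sqrt a <= a * qform (invmx M) x].
Proof.
move=> pP pQ; have [S pS SS] := posdefmx_sqrt pQ.
have uS := posdefmx_unit pS; have symS := posdefmx_sym pS.
have pSPS : posdefmx (S *m P *m S) by rewrite -{1}symS; apply: posdefmx_conj.
have [K pK KK] := posdefmx_sqrt pSPS.
have uK := posdefmx_unit pK.
(* With S the square root of Q and K the square root of S P S, take M = S K^-1 S; then M P M = S
   K^-1 K^2 K^-1 S = Q. *)
exists (S *m invmx K *m S); split.
- by rewrite -{1}symS; apply: posdefmx_conj => //; exact: posdefmx_inv.
- have -> : S *m invmx K *m S *m P *m (S *m invmx K *m S) =
      S *m (invmx K *m (S *m P *m S) *m invmx K) *m S by rewrite !mulmxA.
  by rewrite -KK !mulmxA mulmxKV// mulmxK// SS.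
move=> c a x c0 a0 Pc Qx xx.
have Sx : S *m x = Num.sqrt a *: x.
  by apply: posdefmx_sqrt_eigen (ltW a0) _ => //; rewrite mulmxA SS.
have sa : 0 < Num.sqrt a by rewrite sqrtr_gt0.
have ISx : invmx S *m x = (Num.sqrt a)^-1 *: x.
  by rewrite -[in LHS](scale1r x) -(mulVf (lt0r_neq0 sa)) -scalerA -Sx
    -scalemxAr mulKmx.
(* Here M^-1 = S^-1 K S^-1, and S^-1 divides the eigenvector [x] by the square root of [a]. *)
have -> : a * qform (invmx (S *m invmx K *m S)) x = qform K x.
  have -> : invmx (S *m invmx K *m S) = (invmx S)^T *m K *m invmx S.
    have uM : S *m invmx K *m S \in unitmx.
      by rewrite !unitmx_mul uS unitmx_inv uK.
    rewrite trmx_inv symS; apply: (can_inj (mulKmx uM)).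
    by rewrite mulmxV// !mulmxA mulmxK// mulmxKV// mulmxV.
  rewrite qform_conj ISx !qformE -scalemxAr dotZl dotZr.
  rewrite -{1}[a](sqr_sqrtr (ltW a0)); field; exact: lt0r_neq0.
have -> : Num.sqrt c * Num.sqrt a = qform (Num.sqrt c *: S) x.
  by rewrite qformE -scalemxAl Sx dotZr dotZr xx mulr1.
(* The bound P >= c gives K^2 = S P S >= c S^2, so monotonicity of the square root yields K >= sqrt
   c S. *)
apply: qform_le_of_norm_le => // [|y].
  by rewrite linearZ /= symS.
rewrite -scalemxAl dotZl dotZr mulrA -expr2 sqr_sqrtr// (le_trans (Pc _))//.
rewrite [in leRHS]dotMl (posdefmx_sym pK) mulmxA KK -!mulmxA -qform_conj.
by rewrite qformE symS !mulmxA.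
Qed.

(** The matrix with blocks 1, -y^T, x, 1 factors into block triangular matrices in two ways;
    comparing the determinants gives the identity. *)
Lemma det_rank1_update n (x y : 'cV[R]_n) :
  \det (1%:M + x *m y^T) = 1 + dot y x.
Proof.
have E : block_mx 1%:M 0 x 1%:M *m block_mx 1%:M (- y^T) 0 (1%:M + x *m y^T) =
    block_mx (1%:M + y^T *m x) (- y^T) 0 1%:M *m block_mx 1%:M 0 x 1%:M.
  rewrite !mulmx_block !mul0mx !mulmx0 !mul1mx !mulmx1 !addr0 !add0r.
  by rewrite mulmxN mulNmx addrK [- _ + _]addrCA addNr addr0.
have /(congr1 determinant) := E.
rewrite !det_mulmx !det_lblock !det_ublock !det1 !mul1r !mulr1 => ->.
by rewrite det_mx11 mul_dot !mxE.
Qed.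

End PositiveDefinite.

(** * Affine changes of variables in Lebesgue integrals *)

Section Density.
Context dT (T : measurableType dT) (R : realType).
Variables (mu : {sigma_finite_measure set T -> \bar R}).
Variables (p : probability T R) (f : T -> R).
Hypothesis mf : measurable_fun setT f.
Hypothesis pf : forall A, measurable A -> p A = (\int[mu]_(x in A) (f x)%:E)%E.
Local Open Scope ereal_scope.

Lemma density_null_dominates : p `<< mu.
Proof.
apply/null_content_dominatesP => A mA A0; rewrite pf//.
apply: null_set_integral => //.
apply/measurable_EFinP; exact: measurable_funTS.
Qed.

(** The Radon-Nikodym derivative of [p] has the same integrals over measurable sets as [f], hence
    agrees with it almost everywhere. *)
Lemma ge0_integral_density (g : T -> \bar R) : measurable_fun setT g ->
  (forall x, 0 <= g x) -> \int[p]_x g x = \int[mu]_x (g x * (f x)%:E).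
Proof.
move=> mg g0; have pmu := density_null_dominates.
rewrite -(Radon_Nikodym_SigmaFinite.change_of_variables pmu)//.
have mRN := measurable_int _ (Radon_Nikodym_SigmaFinite.f_integrable pmu).
apply: ae_eq_integral => //.
- exact: emeasurable_funM.
- by apply: emeasurable_funM => //; exact/measurable_EFinP.
apply: ae_eqe_mul2l; apply: integral_ae_eq => //.
- exact: Radon_Nikodym_SigmaFinite.f_integrable.
- exact/measurable_EFinP.
- by move=> A _ mA; rewrite -Radon_Nikodym_SigmaFinite.f_integral//; exact: pf.
Qed.

End Density.

Section TupleSpace.
Variables (R : realType).

Definition unvec d (x : 'cV[R]_d) : Rspace R d := [tuple x i 0 | i < d].

Lemma vecK d : cancel (@vec R d) (@unvec d).
Proof.
by move=> t; apply: eq_from_tnth => i; rewrite tnth_mktuple mxE.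
Qed.

Lemma unvecK d : cancel (@unvec d) (@vec R d).
Proof. by move=> x; apply/colP => i; rewrite mxE tnth_mktuple. Qed.

Lemma vecE d (t : Rspace R d) i j : vec t i j = tnth t i.
Proof. by rewrite mxE. Qed.

Lemma measurable_vec_coord d i j :
  measurable_fun setT (fun t : Rspace R d => vec t i j : R).
Proof.
by under eq_fun do rewrite vecE; exact: measurable_tnth.
Qed.

Definition affine d (L : 'M[R]_d) (b : 'cV[R]_d) (t : Rspace R d) :
  Rspace R d :=
  unvec (L *m vec t + b).

Lemma vec_affine d (L : 'M[R]_d) b t : vec (affine L b t) = L *m vec t + b.
Proof. exact: unvecK. Qed.

Lemma measurable_mulmx_coord d m (L : 'M[R]_(m, d)) i j :
  measurable_fun setT (fun t : Rspace R d => (L *m vec t) i j : R).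
Proof.
under eq_fun do rewrite mxE.
apply: measurable_sum => k; apply: measurable_funM => //.
exact: measurable_vec_coord.
Qed.

Lemma measurable_affine d (L : 'M[R]_d) b : measurable_fun setT (affine L b).
Proof.
apply/measurable_fun_tnthP => i.
rewrite (_ : _ \o _ = fun t : Rspace R d => (L *m vec t) i 0 + b i 0).
  by apply: measurable_funD => //; exact: measurable_mulmx_coord.
by apply/funext => t /=; rewrite tnth_mktuple mxE.
Qed.

Lemma measurable_qform d (A : 'M[R]_d) u :
  measurable_fun setT (fun t : Rspace R d => qform A (vec t - u)).
Proof.
under eq_fun do rewrite qformE dotE.
apply: measurable_sum => i; apply: measurable_funM.
  under eq_fun do rewrite mxE; apply: measurable_funD => //.
  exact: measurable_vec_coord.
under eq_fun do rewrite mulmxBr mxE; apply: measurable_funD => //.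
exact: measurable_mulmx_coord.
Qed.

End TupleSpace.

Section AffineChangeOfVariables.
Variable R : realType.
Local Notation leb := (@lebesgue_tuple R).

(** The rescaled image of Lebesgue measure has the right mass on half-open intervals, so uniqueness
    identifies it with Lebesgue measure. *)
Lemma ge0_integral_affine1 (a b : R) (f : R -> \bar R) : a != 0 ->
  measurable_fun setT f -> (forall x, (0 <= f x)%E) ->
  (\int[lebesgue_measure]_x f x =
   `|a|%:E * \int[lebesgue_measure]_x f (a * x + b)%R)%E.
Proof.
move=> a0 mf f0.
pose T (x : measurableTypeR R) : measurableTypeR R := a * x + b.
have mT : measurable_fun setT T.
  by apply: measurable_funD => //; exact: measurable_funM.
rewrite -[X in (_ * X)%E](@ge0_integral_pushforward _ _ _ _ _ T mT
  lebesgue_measure setT f)//.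
rewrite -(@ge0_integral_mscale _ _ _ (pushforward lebesgue_measure T) setT
  measurableT (NngNum (normr_ge0 a)))//.
apply: eq_measure_integral => A mA _.
apply: lebesgue_measure_unique mA => _ [[x y]] _ <-.
rewrite /= /mscale /= /pushforward lebesgue_measure_itv/= lte_fin.
have [a_gt0|] := ltP 0 a.
  have -> : T @^-1` `]x, y]%classic = `](x - b) / a, (y - b) / a]%classic.
    apply/seteqP; split => t;
      rewrite /= /T !in_itv/= -ltrBlDr -lerBrDr (mulrC a);
      by rewrite ltr_pdivrMr// ler_pdivlMr.
  rewrite lebesgue_measure_itv/= lte_fin ltr_pM2r ?invr_gt0// ltrD2r.
  case: ifPn => _; rewrite ?mule0// -!EFinB -EFinM gtr0_norm//.
  by congr EFin; field.
(* A negative slope reverses the order, so the closed end of the preimage interval changes side. *)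
rewrite le_eqVlt (negPf a0)/= => a_lt0.
have -> : T @^-1` `]x, y]%classic = `[(y - b) / a, (x - b) / a[%classic.
  apply/seteqP; split => t; rewrite /= /T !in_itv/= -ltrBlDr -lerBrDr (mulrC a);
    by rewrite ler_ndivrMr// ltr_ndivlMr// andbC.
rewrite lebesgue_measure_itv/= lte_fin ltr_nM2r ?invr_lt0// ltrD2r.
case: ifPn => _; rewrite ?mule0// -!EFinB -EFinM ltr0_norm//.
by congr EFin; field.
Qed.

Lemma lebesgue_tuple_cons d (f : Rspace R d.+1 -> \bar R) :
  measurable_fun setT f -> (forall t, (0 <= f t)%E) ->
  (\int[leb d.+1]_t f t =
   \int[(lebesgue_measure \x leb d)]_x f (tcons x))%E.
Proof.
move=> mf f0 /=.
by rewrite (ge0_integral_pushforward (@measurable_tcons R d)).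
Qed.

(** [T] multiplies volumes by [c]; the formulation by nonnegative integrals composes directly and
    suits Tonelli's theorem. *)
Definition scales_lebesgue d (T : Rspace R d -> Rspace R d) (c : R) :=
  forall f : Rspace R d -> \bar R, measurable_fun setT f ->
    (forall t, (0 <= f t)%E) ->
    (\int[leb d]_t f t = c%:E * \int[leb d]_t f (T t))%E.

Lemma scales_lebesgue_comp d (T U : Rspace R d -> Rspace R d) c e :
  measurable_fun setT T ->
  scales_lebesgue T c -> scales_lebesgue U e ->
  scales_lebesgue (T \o U) (c * e).
Proof.
move=> mT hT hU f mf f0; rewrite hT// (hU (f \o T)) => [|//|t /=].
- by rewrite muleA EFinM.
- exact: measurableT_comp.
- exact: f0.
Qed.

Lemma vec_tcons d (x : R) (s : Rspace R d) :
  vec (tcons (x, s)) = col_mx x%:M (vec s) :> 'cV[R]_(1 + d).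
Proof.
apply/colP => i; rewrite !mxE (tnth_nth x)/=.
case: (splitP i) => j ->; rewrite !mxE.
  by rewrite !ord1.
by rewrite add1n /= (tnth_nth x).
Qed.

Lemma affine_tcons d (a b1 x : R) (r : 'rV[R]_d) (c b : 'cV[R]_d) (B : 'M[R]_d)
    (s : Rspace R d) :
  @affine R d.+1 (block_mx a%:M r c B : 'M[R]_(1 + d))
    (col_mx b1%:M b : 'cV_(1 + d)) (tcons (x, s)) =
  tcons (a * x + ((r *m vec s) 0 0 + b1), affine B (x *: c + b) s).
Proof.
apply: (can_inj (@vecK R _)); rewrite vec_affine !vec_tcons vec_affine.
rewrite -[LHS]/(block_mx a%:M r c B *m col_mx x%:M (vec s) +
  col_mx b1%:M b : 'cV[R]_(1 + d)).
rewrite (mul_block_col (a%:M : 'M[R]_1)) add_col_mx.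
apply: (congr2 (@col_mx R 1 d 1)).
  apply/matrixP => i j; rewrite !ord1 !mxE big_ord_recl big_ord0.
  by rewrite !mxE !eqxx !mulr1n addr0 addrA.
by rewrite mul_mx_scalar addrA [_ + x *: c]addrC.
Qed.

(** The tail of the vector is transformed independently of its head. Tonelli's theorem allows
    changing the tail at fixed head first, then, after exchanging the integrals, the head by a
    one-dimensional affine map at fixed tail. *)
Lemma scales_lebesgue_upper d (a b1 : R) (r : 'rV[R]_d) (b : 'cV[R]_d)
    (B : 'M[R]_d) e :
  a != 0 -> 0 <= e -> scales_lebesgue (affine B b) e ->
  scales_lebesgue (@affine R d.+1 (block_mx a%:M r 0 B : 'M[R]_(1 + d))
    (col_mx b1%:M b : 'cV_(1 + d))) (`|a| * e).
Proof.
move=> a0 e0 hB f mf f0.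
have mT := @measurable_affine R d.+1 (block_mx a%:M r 0 B) (col_mx b1%:M b).
have mF : measurable_fun setT (f \o @tcons R d).
  by apply: measurableT_comp => //; exact: measurable_tcons.
have mFx x : measurable_fun setT (fun s => f (tcons (x, s))).
  exact: (measurable_fun_pair2 x mF).
have mG : measurable_fun setT
    (fun z : measurableTypeR R * Rspace R d => f (tcons (z.1, affine B b z.2))).
  apply: (measurableT_comp mF); apply: measurable_fun_pair => //.
  exact: (measurableT_comp (measurable_affine B b) measurable_snd).
rewrite !lebesgue_tuple_cons//; last exact: measurableT_comp mf mT.
rewrite (fubini_tonelli1 (f \o @tcons R d))//=.
under eq_integral => x _ do rewrite /fubini_F/= (hB _ (mFx x))//.
rewrite ge0_integralZl//=; first last.
- by move=> x _; apply: integral_ge0.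
- exact: (measurable_fun_fubini_tonelli_F _ mG).
rewrite (fubini_tonelli _ mG)//=.
rewrite mulrC EFinM -muleA; congr (_ * _)%E.
have mH := measurableT_comp (measurableT_comp mf mT) (@measurable_tcons R d).
rewrite (fubini_tonelli2 _ mH)//= -ge0_integralZl//=; first last.
- by move=> x _; apply: integral_ge0 => *; exact: f0.
- exact: (measurable_fun_fubini_tonelli_G _ mH (fun=> f0 _)).
apply: eq_integral => s _; rewrite /fubini_G.
rewrite (ge0_integral_affine1 ((r *m vec s) 0 0 + b1) a0)//; last first.
  exact: (measurable_fun_pair1 s mG).
congr (_ * _)%E; apply: eq_integral => x _ /=.
by rewrite affine_tcons scaler0 add0r.
Qed.

(** At a fixed head [x] the shear only translates the tail by [x *: c], so translation invariance in
    dimension [d] is enough. *)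
Lemma scales_lebesgue_lower d (c : 'cV[R]_d) :
  (forall b, scales_lebesgue (affine (1%:M : 'M[R]_d) b) 1) ->
  scales_lebesgue (@affine R d.+1 (block_mx 1%:M 0 c 1%:M : 'M[R]_(1 + d)) 0) 1.
Proof.
move=> hd f mf f0.
have mT := @measurable_affine R d.+1 (block_mx 1%:M 0 c 1%:M) 0.
have mF : measurable_fun setT (f \o @tcons R d).
  by apply: measurableT_comp => //; exact: measurable_tcons.
rewrite mul1e !lebesgue_tuple_cons//; last exact: measurableT_comp mf mT.
have mH := measurableT_comp (measurableT_comp mf mT) (@measurable_tcons R d).
rewrite (fubini_tonelli1 _ mF (fun=> f0 _)).
rewrite [RHS](fubini_tonelli1 _ mH (fun=> f0 _))/=.
apply: eq_integral => x _; rewrite /fubini_F/= (hd (x *: c)) ?mul1e//.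
  apply: eq_integral => s _.
  have -> : 0 = col_mx 0%:M 0 :> 'cV[R]_(1 + d) by rewrite raddf0 col_mx0.
  by rewrite affine_tcons mul1r mul0mx mxE !addr0.
exact: (measurable_fun_pair2 x mF).
Qed.

Lemma affine_comp d (L1 L2 : 'M[R]_d) b1 b2 :
  affine L1 b1 \o affine L2 b2 = affine (L1 *m L2) (L1 *m b2 + b1).
Proof.
apply/funext => t /=; apply: (can_inj (@vecK R _)).
by rewrite !vec_affine mulmxDr mulmxA addrA.
Qed.

(* Gaussian elimination on the first row and column; when the pivot vanishes, a
   shear by the first column makes it positive. *)
Lemma scales_lebesgue_affine d (L : 'M[R]_d) b :
  L \in unitmx -> scales_lebesgue (affine L b) `|\det L|.
Proof.
elim: d L b => [L b uL|d IHd].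
  move=> f mf f0; rewrite det_mx00 normr1 mul1e.
  by apply: eq_integral => t _; rewrite [affine _ _ _]tuple0 [t]tuple0.
have trd c : scales_lebesgue (affine (1%:M : 'M[R]_d) c) 1.
  by have := IHd 1%:M c (unitmx1 _ _); rewrite det1 normr1.
have upper (a : R) (r : 'rV[R]_d) (B : 'M[R]_d) (c : 'cV[R]_(1 + d)) :
    a != 0 -> B \in unitmx ->
    scales_lebesgue (@affine R d.+1 (block_mx a%:M r 0 B : 'M[R]_(1 + d)) c)
      (`|a| * `|\det B|).
  move=> a0 uB; rewrite -[c]vsubmxK [usubmx c]mx11_scalar.
  exact: scales_lebesgue_upper a0 (normr_ge0 _) (IHd _ _ uB).
have pivot (K : 'M[R]_(1 + d)) (c : 'cV[R]_(1 + d)) :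
    K \in unitmx -> ulsubmx K 0 0 != 0 ->
    scales_lebesgue (@affine R d.+1 K c) `|\det K|.
  move=> uK; set a := ulsubmx K 0 0 => a0.
  pose l := a^-1 *: dlsubmx K; pose r := ursubmx K.
  pose B := drsubmx K - l *m r.
  (* Block LU factorization, with [B] the Schur complement of the pivot. *)
  have KE : K = block_mx 1%:M 0 l 1%:M *m block_mx a%:M r 0 B.
    rewrite mulmx_block !mul1mx !mul0mx !addr0.
    rewrite /l mul_mx_scalar scalerA mulfV// scale1r /B addrC subrK /a.
    by rewrite -mx11_scalar submxK.
  have detK : \det K = a * \det B.
    by rewrite KE det_mulmx det_lblock det_ublock !det1 !mul1r det_scalar1.
  have uB : B \in unitmx.
    move: uK; rewrite !unitmxE !unitfE detK mulf_eq0 negb_or.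
    by case/andP.
  pose c' := block_mx 1%:M 0 (- l) 1%:M *m c.
  have c'E : block_mx 1%:M 0 l 1%:M *m c' = c.
    rewrite /c' mulmxA mulmx_block !mul1mx !mul0mx !mulmx0 !mulmx1 !addr0.
    by rewrite !add0r subrr -scalar_mx_block mul1mx.
  have -> : @affine R d.+1 K c =
      @affine R d.+1 (block_mx 1%:M 0 l 1%:M) 0 \o
      @affine R d.+1 (block_mx a%:M r 0 B) c'.
    by rewrite affine_comp addr0 -KE c'E.
  rewrite detK normrM -[_ * _]mul1r.
  apply: scales_lebesgue_comp; first exact: measurable_affine.
    exact: scales_lebesgue_lower.
  exact: upper.
suff: forall (L : 'M[R]_(1 + d)) (b : 'cV[R]_(1 + d)), L \in unitmx ->
    scales_lebesgue (@affine R d.+1 L b) `|\det L| by exact.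
move=> L b uL.
pose c : 'cV[R]_d := dlsubmx L.
have [a0|] := eqVneq (ulsubmx L 0 0) 0; last exact: pivot.
(* With a zero pivot, a zero column below it would make [L] singular. *)
have c0 : c != 0.
  apply: contraL uL => /eqP c0; rewrite unitmxE unitfE negbK.
  rewrite -(submxK L) -/c c0 det_ublock det_mx11.
  by rewrite a0 mul0r.
(* Adding [c^T] times the lower rows to the first row replaces the zero pivot by [dot c c]; [S (-1)]
   undoes [S 1]. *)
pose S (e : R) : 'M[R]_(1 + d) := block_mx 1%:M (e *: c^T) 0 1%:M.
have detS e : \det (S e) = 1 by rewrite det_ublock !det1 mul1r.
have SS : S (-1) *m S 1 = 1%:M.
  rewrite /S mulmx_block !mul1mx !mul0mx !mulmx0 !mulmx1 !addr0 !add0r.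
  by rewrite scale1r scaleN1r subrr -scalar_mx_block.
have -> : @affine R d.+1 L b =
    @affine R d.+1 (S (-1)) 0 \o @affine R d.+1 (S 1 *m L) (S 1 *m b).
  by rewrite affine_comp !mulmxA SS !mul1mx addr0.
have -> : `|\det L| = `|1| * `|\det (1%:M : 'M[R]_d)| * `|\det (S 1 *m L)|.
  by rewrite det1 det_mulmx detS normr1 !mul1r.
apply: scales_lebesgue_comp; first exact: measurable_affine.
  exact: (upper _ _ _ _ (oner_neq0 _) (unitmx1 _ _)).
apply: pivot.
  by rewrite unitmxE det_mulmx detS mul1r -unitmxE.
rewrite /S -(submxK L) -/c mulmx_block block_mxKul mul1mx scale1r.
by rewrite mxE a0 add0r; rewrite -[_ 0 0]/(dot c c) dot_eq0.
Qed.

End AffineChangeOfVariables.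

(** * Gaussian laws *)

Section Mean.
Context dT (T : measurableType dT) (R : realType).
Implicit Types (p : probability T R) (f g : T -> R).

(** Integrability travels with the value, so linearity rules can be chained without separate
    finiteness arguments. *)
Definition has_mean p f (m : R) : Prop :=
  p.-integrable setT (EFin \o f) /\ (\int[p]_x (f x)%:E = m%:E)%E.

Lemma has_mean_cst p c : has_mean p (fun=> c) c.
Proof.
split; first exact: finite_measure_integrable_cst.
by rewrite integral_cst//= probability_setT mule1.
Qed.

Lemma has_meanD p f g m n :
  has_mean p f m -> has_mean p g n -> has_mean p (fun x => f x + g x) (m + n).
Proof.
move=> [fi fm] [gi gn]; split; first exact: (integrableD measurableT fi gi).
by under eq_integral do rewrite EFinD; rewrite integralD// fm gn.
Qed.

Lemma has_meanZ p c f m :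
  has_mean p f m -> has_mean p (fun x => c * f x) (c * m).
Proof.
move=> [fi fm]; split; first exact: (integrableZl measurableT c fi).
by under eq_integral do rewrite EFinM; rewrite integralZl// fm.
Qed.

Lemma has_mean_sum p (I : Type) (r : seq I) (f : I -> T -> R) (m : I -> R) :
  (forall i, has_mean p (f i) (m i)) ->
  has_mean p (fun x => \sum_(i <- r) f i x) (\sum_(i <- r) m i).
Proof.
move=> fm; elim: r => [|i r IHr].
  rewrite big_nil; under eq_fun do rewrite big_nil; exact: has_mean_cst.
by rewrite big_cons; under eq_fun do rewrite big_cons; exact: has_meanD.
Qed.

Lemma has_mean_le p f g m n : (forall x, f x <= g x) ->
  has_mean p f m -> has_mean p g n -> m <= n.
Proof.
move=> fg [fi fm] [gi gn]; rewrite -lee_fin -fm -gn.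
by apply: le_integral => // x _; rewrite lee_fin.
Qed.

Lemma has_mean_dominated p f g n : measurable_fun setT f ->
  (forall x, `|f x| <= g x) -> has_mean p g n -> exists m, has_mean p f m.
Proof.
move=> mf fg [gi gn].
have fi : p.-integrable setT (EFin \o f).
  apply: le_integrable gi => //; first exact/measurable_EFinP.
  by move=> x _ /=; rewrite lee_fin (le_trans (fg x))// ler_norm.
exists (fine (\int[p]_x (f x)%:E)); split => //.
by rewrite fineK//; exact: integrable_fin_num fi.
Qed.

End Mean.

Lemma has_mean_pushforward d1 d2 (T1 : measurableType d1)
    (T2 : measurableType d2) (R : realType) (p : probability T1 R)
    (q : probability T2 R) (h : T1 -> T2)
    (f : T2 -> R) m :
  measurable_fun setT h ->
  (forall A, measurable A -> q A = p (h @^-1` A)) ->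
  has_mean q f m -> has_mean p (f \o h) m.
Proof.
move=> mh qp [/integrableP[mf foo] fm].
have eqq (g : T2 -> \bar R) : (\int[q]_y g y = \int[pushforward p h]_y g y)%E.
  by apply: eq_measure_integral => A mA _; exact: qp.
have pi : p.-integrable setT (EFin \o f \o h).
  apply/integrableP; split; first exact: measurableT_comp.
  move: foo; rewrite eqq (ge0_integral_pushforward mh)//.
  exact: measurableT_comp.
split=> //; rewrite -fm eqq (integral_pushforward mh)//.
Qed.

Section Gaussian.
Variables (R : realType) (d : nat).
Implicit Types (P L : 'M[R]_d) (u b w : 'cV[R]_d).
Implicit Types p : probability (Rspace R d) R.
Local Notation leb := (@lebesgue_tuple R d).

Lemma gaussian_pdf_gt0 u P t : posdefmx P -> 0 < gaussian_pdf u P t.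
Proof.
move=> pP; rewrite mulr_gt0 ?expR_gt0// invr_gt0 sqrtr_gt0.
by rewrite mulr_gt0 ?posdefmx_det// exprn_gt0// mulr_gt0// pi_gt0.
Qed.

Lemma measurable_gaussian_pdf u P : measurable_fun setT (gaussian_pdf u P).
Proof.
apply: measurable_funM => //; apply: measurableT_comp => //.
apply: measurableT_comp => //; apply: measurable_funM => //.
exact: measurable_qform.
Qed.

(** The exponent is invariant under the change of variables, and the normalizing constant absorbs
    the Jacobian. *)
Lemma gaussian_pdf_affine u P L b t : P \in unitmx -> L \in unitmx ->
  gaussian_pdf u P t =
  `|\det L| * gaussian_pdf (L *m u + b) (L *m P *m L^T) (affine L b t).
Proof.
move=> uP uL; rewrite /gaussian_pdf vec_affine.
have -> : L *m vec t + b - (L *m u + b) = L *m (vec t - u).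
  by rewrite mulmxBr opprD addrACA subrr addr0.
have -> : qform (invmx (L *m P *m L^T)) (L *m (vec t - u)) =
    qform (invmx P) (vec t - u).
  rewrite -qform_conj; congr (qform _ _).
  have uS : L *m P *m L^T \in unitmx by rewrite !unitmx_mul unitmx_tr uL uP.
  apply: (can_inj (mulKmx uP)); apply: (can_inj (mulKmx uL)).
  by rewrite mulmxV// mulmx1 !mulmxA mulmxV// mul1mx.
rewrite !det_mulmx det_tr.
have -> : (2 * pi) ^+ d * (\det L * \det P * \det L) =
    \det L ^+ 2 * ((2 * pi) ^+ d * \det P) by ring.
rewrite (sqrtrM _ (sqr_ge0 (\det L))) sqrtr_sqr invfM !mulrA mulfV ?mul1r//.
by rewrite normr_eq0 -unitfE -unitmxE.
Qed.

Lemma ge0_integral_gaussian p u P (g : Rspace R d -> \bar R) :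
  gaussian_law p u P -> measurable_fun setT g -> (forall x, (0 <= g x)%E) ->
  (\int[p]_t g t = \int[leb]_t (g t * (gaussian_pdf u P t)%:E))%E.
Proof.
move=> pl mg g0.
exact: (ge0_integral_density (measurable_gaussian_pdf u P) pl).
Qed.

Lemma posdefmx_affine P L : posdefmx P -> L \in unitmx ->
  posdefmx (L *m P *m L^T).
Proof.
by move=> pP uL; rewrite -{1}[L]trmxK; apply: posdefmx_conj; rewrite ?unitmx_tr.
Qed.

(** Besides its Gaussian form, the image law is recorded as a pushforward: this is what later makes
    the graph of the affine map a coupling. *)
Lemma gaussian_affine p u P L b :
  posdefmx P -> gaussian_law p u P -> L \in unitmx ->
  exists q : probability (Rspace R d) R,
    nondegenerate_gaussian q (L *m u + b) (L *m P *m L^T) /\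
    forall A, measurable A -> q A = p (affine L b @^-1` A).
Proof.
move=> pP pl uL; have pP' := posdefmx_affine pP uL.
have mT := measurable_affine L b.
pose X : {mfun Rspace R d >-> Rspace R d} :=
  HB.pack (affine L b) (isMeasurableFun.Build _ _ _ _ _ mT).
exists (distribution p X); split; last by [].
split; first exact: pP'.
move=> A mA; have mpdf := measurable_gaussian_pdf (L *m u + b) (L *m P *m L^T).
transitivity (\int[leb]_(t in affine L b @^-1` A) (gaussian_pdf u P t)%:E)%E.
  apply: pl; rewrite -[Y in measurable Y]setTI.
  by apply: (measurable_affine L b).
rewrite integral_mkcond [RHS]integral_mkcond.
rewrite [RHS](scales_lebesgue_affine b uL); last 2 first.
- apply/(measurable_restrictT _ mA)/measurable_EFinP; exact: measurable_funTS.
- by apply: erestrict_ge0 => t _; rewrite lee_fin; exact/ltW/gaussian_pdf_gt0.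
rewrite -ge0_integralZl//; last 2 first.
- apply: (measurableT_comp _ mT).
  apply/(measurable_restrictT _ mA)/measurable_EFinP; exact: measurable_funTS.
- move=> t _; apply: erestrict_ge0 => {}t _; rewrite lee_fin.
  exact/ltW/gaussian_pdf_gt0.
apply: eq_integral => t _; rewrite !patchE/=.
have -> : (t \in affine L b @^-1` A) = (affine L b t \in A).
  by apply/idP/idP; rewrite !inE.
case: ifPn => _; last by rewrite mule0.
by rewrite -EFinM -gaussian_pdf_affine// posdefmx_unit.
Qed.

End Gaussian.

(** * First and second moments of a Gaussian law *)

Section GaussianMoments.
Variables (R : realType) (d : nat) (p : probability (Rspace R d) R).
Variables (u : 'cV[R]_d) (P : 'M[R]_d).
Hypotheses (pP : posdefmx P) (pl : gaussian_law p u P).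
Local Notation leb := (@lebesgue_tuple R d).

Lemma integral_gaussian_pdf : (\int[leb]_t (gaussian_pdf u P t)%:E = 1)%E.
Proof. by rewrite -(probability_setT p); apply/esym; exact: pl. Qed.

Lemma measurable_dot_vec w :
  measurable_fun setT (fun t : Rspace R d => dot w (vec t - u)).
Proof.
under eq_fun do rewrite dotE.
apply: measurable_sum => i; apply: measurable_funM => //.
under eq_fun do rewrite mxE; apply: measurable_funD => //.
exact: measurable_vec_coord.
Qed.

(* Stretching by a factor s along P w multiplies the density by the integrand
   and Lebesgue measure by s. *)
Lemma gaussian_laplace_sqr w s : dot w (P *m w) = 1 -> 0 < s ->
  (\int[p]_t (expR (- ((s ^+ 2 - 1) / 2 * dot w (vec t - u) ^+ 2)))%:E
   = s^-1%:E)%E.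
Proof.
move=> wPw s0; have uP := posdefmx_unit pP.
(* The normalization of [w] makes this rank-one update have determinant [s]; the shift [b] below
   fixes the mean [u]. *)
pose L := 1%:M + ((s - 1) *: (P *m w)) *m w^T.
have detL : \det L = s.
  by rewrite det_rank1_update dotZr wPw mulr1 addrC subrK.
have uL : L \in unitmx by rewrite unitmxE unitfE detL gt_eqF.
pose b := u - L *m u.
rewrite (ge0_integral_gaussian pl); last 2 first.
- apply/measurable_EFinP; apply: measurableT_comp => //.
  apply: measurableT_comp => //; apply: measurable_funM => //.
  by apply: measurable_funX; exact: measurable_dot_vec.
- by move=> t; rewrite lee_fin expR_ge0.
transitivity (\int[leb]_t (gaussian_pdf u P (affine L b t))%:E)%E.
  apply: eq_integral => t _; rewrite -EFinM; congr EFin.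
  rewrite /gaussian_pdf mulrCA -expRD vec_affine; congr (_ * expR _).
  have -> : L *m vec t + b - u = L *m (vec t - u).
    by rewrite /b mulmxBr addrA addrAC addrK.
  move: (vec t - u) => x.
  have -> : L *m x = x + ((s - 1) * dot w x) *: (P *m w).
    by rewrite /L mulmxDl mul1mx outer_mul scalerA mulrC.
  rewrite !qformE mulmxDr -scalemxAr mulKmx// !dotDl !dotDr !dotZl !dotZr.
  have -> : dot (P *m w) (invmx P *m x) = dot w x.
    by rewrite dotMl (posdefmx_sym pP) mulKVmx.
  rewrite [dot (P *m w) w]dotC wPw (dotC x w).
  by field.
have := integral_gaussian_pdf.
rewrite (scales_lebesgue_affine b uL); last 2 first.
- by apply/measurable_EFinP; exact: measurable_gaussian_pdf.
- by move=> t; rewrite lee_fin ltW// gaussian_pdf_gt0.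
rewrite detL gtr0_norm// => /(congr1 (fun z => s^-1%:E * z)%E).
by rewrite muleA -EFinM mulVf ?gt_eqF// mul1e mule1.
Qed.

(** Both sides equal 1 at s = 1, so their slopes -m and -1 must agree there. *)
Lemma eq1_of_laplace_bound (m : R) :
  (forall s, 0 < s -> 1 - (s ^+ 2 - 1) / 2 * m <= s^-1) -> m = 1.
Proof.
move=> H.
(* Multiplying by 2 s exposes the factor s - 1; the second factor tends to 2 (m - 1) as s tends to
   1, so it must have the sign of s - 1 on both sides. *)
have {}H s : 0 < s -> 0 <= (s - 1) * (s * (s + 1) * m - 2).
  move=> s0; have := H s s0; rewrite -(ler_pM2l s0) mulfV ?gt_eqF// => Hs.
  by nra.
apply/eqP; rewrite eq_le; apply/andP; split; rewrite leNgt; apply/negP => m1.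
  (* At s = 1 - e the second factor is m - 1 + e^2 m, still positive. *)
  pose e := (m - 1) / (3 * m).
  have em : e * (3 * m) = m - 1 by rewrite /e divfK//; apply/eqP; lra.
  have e0 : 0 < e by rewrite divr_gt0//; lra.
  have e1 : e < 1 by nra.
  have := H (1 - e) ltac:(lra).
  have : 0 < (1 - e) * (1 - e + 1) * m - 2 by nra.
  by move=> /(mulr_gt0 e0); lra.
have [m0|m0] := lerP m 0.
  by have := H 2 ltac:(lra); nra.
pose e := (1 - m) / 4.
have := H (1 + e) ltac:(rewrite /e; lra).
have e0 : 0 < e by rewrite /e; lra.
have : (1 + e) * (1 + e + 1) * m - 2 < 0 by rewrite /e; nra.
by rewrite -oppr_gt0 => /(mulr_gt0 e0); lra.
Qed.

(** One exponential moment gives integrability; then integrating exp z >= 1 + z in the Laplace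
    formula for every [s] determines the mean, without differentiating under the integral. *)
Lemma gaussian_second_moment1 w : dot w (P *m w) = 1 ->
  has_mean p (fun t => dot w (vec t - u) ^+ 2) 1.
Proof.
move=> wPw; pose Y (t : Rspace R d) := dot w (vec t - u) ^+ 2.
have mY : measurable_fun setT Y.
  by apply: measurable_funX; exact: measurable_dot_vec.
have lap s : 0 < s ->
    has_mean p (fun t => expR (- ((s ^+ 2 - 1) / 2 * Y t))) s^-1.
  move=> s0; have E := gaussian_laplace_sqr wPw s0; split=> //.
  apply/integrableP; split.
    apply/measurable_EFinP; apply: measurableT_comp => //.
    by apply: measurableT_comp => //; exact: measurable_funM.
  under eq_integral do rewrite /= ger0_norm ?expR_ge0//.
  by rewrite E ltry.
have [m Ym] : exists m, has_mean p Y m.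
  (* For s^2 = 1/2 the exponent is Y / 4, and Y <= 4 exp (Y / 4). *)
  have s0 : 0 < Num.sqrt (2^-1 : R) by rewrite sqrtr_gt0 invr_gt0.
  apply: (has_mean_dominated mY _ (has_meanZ 4 (lap _ s0))) => t.
  rewrite sqr_sqrtr ?invr_ge0// ger0_norm ?sqr_ge0//.
  have -> : - ((2^-1 - 1) / 2 * Y t) = Y t / 4 by field.
  have := expR_ge1Dx (Y t / 4); rewrite -/(Y t).
  by lra.
suff <- : m = 1 by [].
apply: eq1_of_laplace_bound => s s0.
have H : has_mean p (fun t => 1 + - ((s ^+ 2 - 1) / 2) * Y t)
    (1 + - ((s ^+ 2 - 1) / 2) * m).
  by apply: has_meanD; [exact: has_mean_cst|exact: has_meanZ].
rewrite -mulNr; apply: has_mean_le H (lap s s0) => t.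
by rewrite mulNr; exact: expR_ge1Dx.
Qed.

Lemma gaussian_second_moment w :
  has_mean p (fun t => dot w (vec t - u) ^+ 2) (dot w (P *m w)).
Proof.
have [->|w0] := eqVneq w 0.
  rewrite /dot trmx0 !mul0mx mxE.
  have := has_mean_cst p 0; congr has_mean; apply/funext => t.
  by rewrite mul0mx mxE expr0n.
have := pP.2 w w0; rewrite qformE; set a := dot w _ => a0.
pose v := (Num.sqrt a)^-1 *: w.
have sa : Num.sqrt a != 0 by rewrite gt_eqF// sqrtr_gt0.
have vPv : dot v (P *m v) = 1.
  rewrite -scalemxAr dotZl dotZr -/a mulrA -invfM -expr2 sqr_sqrtr ?ltW//.
  by rewrite mulVf// gt_eqF.
have := has_meanZ a (gaussian_second_moment1 vPv); rewrite mulr1.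
congr has_mean; apply/funext => t; rewrite dotZl exprMn exprVn.
by rewrite sqr_sqrtr ?ltW// mulVKf// gt_eqF.
Qed.

(** Polarization of the second moment. *)
Lemma gaussian_covariance w z :
  has_mean p (fun t => dot w (vec t - u) * dot z (vec t - u)) (dot w (P *m z)).
Proof.
have Hp := has_meanZ (4^-1) (gaussian_second_moment (w + z)).
have Hm := has_meanZ (- 4^-1) (gaussian_second_moment (w - z)).
have := has_meanD Hp Hm.
have -> : 4^-1 * dot (w + z) (P *m (w + z)) +
    - 4^-1 * dot (w - z) (P *m (w - z)) = dot w (P *m z).
  rewrite !mulmxDr mulmxN !dotDl !dotDr !dotNl !dotNr.
  by rewrite (dotMr _ z w) (posdefmx_sym pP) (dotC _ w); field.
congr has_mean; apply/funext => t.
by rewrite !dotDl !dotNl; field.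
Qed.

(** The reflection t -> 2 u - t preserves the law, so the mean equals its own opposite; it exists
    because |y| <= 1 + y^2. *)
Lemma gaussian_first_moment w : has_mean p (fun t => dot w (vec t - u)) 0.
Proof.
have [m Ym] : exists m, has_mean p (fun t => dot w (vec t - u)) m.
  apply: (has_mean_dominated (measurable_dot_vec w) _
    (has_meanD (has_mean_cst p 1) (gaussian_second_moment w))) => t.
  rewrite -real_normK ?num_real//.
  by have := normr_ge0 (dot w (vec t - u)); nra.
have uL : (-1)%:M \in @unitmx R d.
  by rewrite unitmxE det_scalar rpredX// unitrN1.
have [q [[_ ql] qp]] := gaussian_affine (u + u) pP pl uL.
have pq A : measurable A -> p A = q A.
  move=> mA; apply: (etrans (pl mA)); apply: etrans (esym (ql _ mA)).
  apply: eq_integral => t _; congr (EFin _).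
  congr (gaussian_pdf _ _ t); first by rewrite mul_scalar_mx scaleN1r addKr.
  by rewrite tr_scalar_mx mul_scalar_mx mul_mx_scalar !scaleN1r opprK.
have Ym' : has_mean q (fun t => dot w (vec t - u)) m.
  exact: (has_mean_pushforward (@measurable_id _ _ setT) pq Ym).
have [_ Em] := has_meanZ (-1) Ym.
have [_ E] := has_mean_pushforward (measurable_affine _ _) qp Ym'.
suff -> : 0 = m by [].
have [] : (m%:E = (-1 * m)%:E)%E; last by lra.
rewrite -E -Em; apply: eq_integral => t _; rewrite /= vec_affine.
by rewrite mul_scalar_mx scaleN1r addrA addrK mulN1r -dotNr opprB addrC.
Qed.

(** The common form of the expectations needed below: log-density ratios, Kantorovich potentials and
    costs of affine couplings are all quadratic in [vec t - u]. *)
Lemma gaussian_mean_quadratic (A : 'M[R]_d) w c :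
  has_mean p (fun t => qform A (vec t - u) + (dot w (vec t - u) + c))
    (\tr (A *m P) + c).
Proof.
apply: has_meanD; last first.
  rewrite -[c in X in has_mean _ _ X]add0r.
  by apply: has_meanD; [exact: gaussian_first_moment|exact: has_mean_cst].
pose e i : 'cV[R]_d := delta_mx i 0.
have eE (x : 'cV[R]_d) i : dot (e i) x = x i 0.
  rewrite dotE (bigD1 i)//= big1 ?addr0 ?mxE ?eqxx ?mul1r// => j /negPf ji.
  by rewrite mxE ji mul0r.
have := has_mean_sum (index_enum _) (fun i => has_mean_sum (index_enum _)
  (fun j => has_meanZ (A i j) (gaussian_covariance (e i) (e j)))).
congr has_mean.
  apply/funext => t; rewrite qformE dotE; apply: eq_bigr => i _.
  rewrite [X in _ = _ * X]mxE mulr_sumr; apply: eq_bigr => j _.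
  by rewrite !eE mulrCA.
rewrite /mxtrace; apply: eq_bigr => i _; rewrite mxE; apply: eq_bigr => j _.
by rewrite eE -colE mxE -{1}(posdefmx_sym pP) mxE.
Qed.

End GaussianMoments.

(** * Closed form of the relative entropy between Gaussians *)

Section RelativeEntropy.
Variables (R : realType) (d : nat).
Implicit Types (p q nu : probability (Rspace R d) R).
Local Notation leb := (@lebesgue_tuple R d).

Definition gaussian_KL (v : 'cV[R]_d) (Q : 'M[R]_d) (m : 'cV[R]_d)
    (S : 'M[R]_d) :=
  (\tr (invmx S *m Q) - d%:R + ln (\det S) - ln (\det Q) +
    qform (invmx S) (v - m)) / 2.

(** The ratio is expanded around [v], the mean of the law against which it will be integrated. *)
Lemma ln_gaussian_ratio (v m : 'cV[R]_d) (Q S : 'M[R]_d) t :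
  posdefmx Q -> posdefmx S ->
  ln (gaussian_pdf v Q t / gaussian_pdf m S t) =
  qform (2^-1 *: (invmx S - invmx Q)) (vec t - v) +
  (dot (invmx S *m (v - m)) (vec t - v) +
   (ln (\det S) - ln (\det Q) + qform (invmx S) (v - m)) / 2).
Proof.
move=> pQ pS; rewrite ln_div ?posrE ?gaussian_pdf_gt0//.
have lnpdf (x : 'cV[R]_d) (X : 'M[R]_d) : posdefmx X ->
    ln (gaussian_pdf x X t) =
    - (ln ((2 * pi) ^+ d) + ln (\det X)) / 2 - qform (invmx X) (vec t - x) / 2.
  move=> pX; have c0 : 0 < (2 * pi) ^+ d :> R.
    by rewrite exprn_gt0// mulr_gt0// pi_gt0.
  have dX := posdefmx_det pX.
  have cd0 : 0 < Num.sqrt ((2 * pi) ^+ d * \det X).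
    by rewrite sqrtr_gt0 mulr_gt0.
  rewrite /gaussian_pdf lnM ?posrE ?invr_gt0// ?expR_gt0// expRK lnV ?posrE//.
  congr (_ - _); rewrite mulNr; congr (- _).
  rewrite -lnM ?posrE// -[in RHS](sqr_sqrtr (ltW (mulr_gt0 c0 dX))) lnXn//.
  by rewrite [ln _ *+ 2]mulr2n; field.
rewrite !lnpdf//.
have -> : vec t - m = (vec t - v) + (v - m) by rewrite addrA subrK.
move: (vec t - v) (v - m) => x w.
rewrite !qformE -scalemxAl dotZr mulmxBl mulmxDr !dotDl !dotDr dotNr.
rewrite (dotMr (invmx S) x w) trmx_inv (posdefmx_sym pS) (dotMl (invmx S) w x).
rewrite trmx_inv (posdefmx_sym pS) (dotMl (invmx S) x w).
rewrite trmx_inv (posdefmx_sym pS).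
rewrite (dotMr (invmx S) x w) trmx_inv (posdefmx_sym pS) (dotC (invmx S *m x)).
by field.
Qed.

Lemma KL_gaussian q nu v Q m S :
  nondegenerate_gaussian q v Q -> nondegenerate_gaussian nu m S ->
  KL q nu = (gaussian_KL v Q m S)%:E.
Proof.
move=> [pQ ql] [pS nul].
pose r t := gaussian_pdf v Q t / gaussian_pdf m S t.
have r0 t : 0 <= r t by rewrite ltW// divr_gt0// gaussian_pdf_gt0.
have mpQ := measurable_gaussian_pdf v Q.
have mpS := measurable_gaussian_pdf m S.
have mr : measurable_fun setT r.
  have -> : r = fun t => expR (ln (r t)).
    by apply/funext => t; rewrite lnK// posrE divr_gt0// gaussian_pdf_gt0.
  apply: measurableT_comp => //.
  under eq_fun do rewrite ln_gaussian_ratio//.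
  apply: measurable_funD; first exact: measurable_qform.
  by apply: measurable_funD => //; exact: measurable_dot_vec.
have qr A : measurable A -> q A = (\int[nu]_(t in A) (r t)%:E)%E.
  move=> mA; rewrite ql// integral_mkcond [RHS]integral_mkcond.
  rewrite (ge0_integral_gaussian nul); last 2 first.
  - apply/(measurable_restrictT _ mA)/measurable_EFinP; exact: measurable_funTS.
  - by apply: erestrict_ge0 => t _; rewrite lee_fin.
  apply: eq_integral => t _; rewrite !patchE; case: ifPn => _; last first.
    by rewrite mul0e.
  by rewrite -EFinM divfK// gt_eqF// gaussian_pdf_gt0.
have qnu : q `<< nu := density_null_dominates mr qr.
rewrite /KL; case: asboolP => // _.
(* Uniqueness of the derivative holds [nu]-almost everywhere and passes to [q] by absolute
   continuity. *)
have RNE : ae_eq q setT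
      (Radon_Nikodym (charge_of_finite_measure q) nu) (EFin \o r).
  apply: (null_dominates_ae_eq measurableT qnu); apply: integral_ae_eq.
  - exact: measurableT.
  - exact: Radon_Nikodym_integrable.
  - exact/measurable_EFinP.
  - by move=> A _ mA; rewrite -Radon_Nikodym_integral//; exact: qr.
have := gaussian_mean_quadratic pQ ql (2^-1 *: (invmx S - invmx Q))
  (invmx S *m (v - m))
  ((ln (\det S) - ln (\det Q) + qform (invmx S) (v - m)) / 2).
move=> [lni lnE].
transitivity (\int[q]_t (ln (r t))%:E)%E.
  apply: ae_eq_integral => //.
  - apply/measurable_EFinP; apply: measurableT_comp => //.
    apply: (measurableT_comp (fine_measurable measurableT)).
    by apply: (measurable_int nu); exact: Radon_Nikodym_integrable.
  - by apply/measurable_EFinP; exact: measurableT_comp.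
  - by move: RNE; apply: filterS => t /= /(_ I) E _; rewrite E.
under eq_integral do rewrite ln_gaussian_ratio//.
rewrite lnE; congr EFin; rewrite /gaussian_KL.
rewrite -scalemxAl mulmxBl linearZ/= raddfB/= mulVmx ?posdefmx_unit// mxtrace1.
by field.
Qed.

End RelativeEntropy.

(** * Transport cost and minimizers *)

Section Wasserstein.
Variables (R : realType) (d : nat).
Local Notation E := (Rspace R d).
Implicit Types (p q mu nu : probability E R) (P Q L M : 'M[R]_d).

Lemma sqdistE (x : E * E) :
  sqdist x = dot (vec x.1 - vec x.2) (vec x.1 - vec x.2).
Proof. by rewrite dotE; apply: eq_bigr => i _; rewrite !mxE -expr2. Qed.

Lemma sqdist_ge0 (x : E * E) : 0 <= sqdist x.
Proof. by rewrite sqdistE dot_ge0. Qed.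

Lemma measurable_sqdist : measurable_fun setT (@sqdist R d).
Proof.
apply: measurable_sum => i; apply: measurable_funX; apply: measurable_funB.
  exact: (measurableT_comp (measurable_tnth i) measurable_fst).
exact: (measurableT_comp (measurable_tnth i) measurable_snd).
Qed.

(** An infinite integral of [f] is harmless, and a finite one makes [f] integrable; so weak duality
    covers couplings of infinite cost. *)
Lemma integral_ge_mean dT (T : measurableType dT) (g : probability T R)
    (f h : T -> R) m :
  measurable_fun setT f -> (forall x, 0 <= f x) -> (forall x, h x <= f x) ->
  has_mean g h m -> (m%:E <= \int[g]_x (f x)%:E)%E.
Proof.
move=> mf f0 hf [hi hm].
have [->|foo] := eqVneq (\int[g]_x (f x)%:E)%E +oo%E; first exact: leey.
rewrite -hm; apply: le_integral => //; last by move=> x _; rewrite lee_fin.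
apply/integrableP; split; first exact/measurable_EFinP.
under eq_integral do rewrite /= ger0_norm//.
by rewrite ltey.
Qed.

(* Weak Kantorovich duality with the quadratic potentials
   xi . (1 - M) xi and eta . (1 - M^-1) eta. *)
Lemma W2sq_ge p q u v P Q M :
  nondegenerate_gaussian p u P -> nondegenerate_gaussian q v Q ->
  posdefmx M -> M *m P *m M = Q ->
  ((dot (u - v) (u - v) + \tr P + \tr Q - 2 * \tr (M *m P))%:E <= W2sq p q)%E.
Proof.
move=> [pP pl] [pQ ql] pM MPM; have uM := posdefmx_unit pM.
have symM := posdefmx_sym pM.
apply: le_ereal_inf_tmp => _ [g gpq <-].
set w := u - v.
have Hp := has_mean_pushforward measurable_fst
  (fun A mA => esym (proj1 (gpq A mA)))
  (gaussian_mean_quadratic pP pl (1%:M - M) (2 *: w) (dot w w)).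
have Hq := has_mean_pushforward measurable_snd
  (fun A mA => esym (proj2 (gpq A mA)))
  (gaussian_mean_quadratic pQ ql (1%:M - invmx M) (- (2 *: w)) 0).
have -> : dot w w + \tr P + \tr Q - 2 * \tr (M *m P) =
    \tr ((1%:M - M) *m P) + dot w w + (\tr ((1%:M - invmx M) *m Q) + 0).
  rewrite !mulmxBl !mul1mx !raddfB/= -[in invmx M *m Q]MPM !mulmxA.
  by rewrite mulVmx// mul1mx (mxtrace_mulC P); ring.
apply: (integral_ge_mean measurable_sqdist sqdist_ge0 _
  (has_meanD Hp Hq)) => t /=.
rewrite sqdistE.
have -> : vec t.1 - vec t.2 = (vec t.1 - u) - (vec t.2 - v) + w.
  by apply/colP => i; rewrite !mxE; ring.
move: (vec t.1 - u) (vec t.2 - v) (w) => x y z.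
(* The cost minus the two potentials is exactly this nonnegative form; the linear terms account for
   the shift of means. *)
have := posdefmx_qform_ge0 (x - invmx M *m y) pM.
rewrite !qformE !mulmxBr !mulmxBl !mul1mx !mulKVmx//.
rewrite !dotDl !dotDr !dotNl !dotNr !dotZl.
rewrite (dotC (invmx M *m y) (M *m x)) (dotMl M x) symM mulKVmx//.
rewrite (dotC (invmx M *m y) y) (dotC y x) (dotC x z) (dotC y z).
by lra.
Qed.

(** The coupling carried by the graph of the affine map has this cost. Keeping [w] free lets the
    mean shift be matched with the one in the dual bound. *)
Lemma W2sq_le p u P L b q :
  nondegenerate_gaussian p u P ->
  (forall A, measurable A -> q A = p (affine L b @^-1` A)) ->
  forall w, w = u - (L *m u + b) ->
  (W2sq p q <= (dot w w + \tr P + \tr (L *m P *m L^T) - 2 * \tr (L *m P))%:E)%E.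
Proof.
move=> [pP pl] qp w wE.
have mT := measurable_affine L b.
have mh : measurable_fun setT (fun t : E => (t, affine L b t)).
  exact: measurable_fun_pair.
pose X : {mfun E >-> (E * E)%type} :=
  HB.pack (fun t : E => (t, affine L b t)) (isMeasurableFun.Build _ _ _ _ _ mh).
apply: ereal_inf_lbound; exists (distribution p X).
  move=> A mA; split; first by [].
  by rewrite qp.
rewrite /distribution (ge0_integral_pushforward mh)//=; last 2 first.
- by apply/measurable_EFinP; exact: measurable_sqdist.
- by move=> x _; rewrite lee_fin sqdist_ge0.
have [_] := gaussian_mean_quadratic pP pl ((1%:M - L)^T *m (1%:M - L))
  (2 *: ((1%:M - L)^T *m w)) (dot w w).
have -> : \tr ((1%:M - L)^T *m (1%:M - L) *m P) + dot w w =
    dot w w + \tr P + \tr (L *m P *m L^T) - 2 * \tr (L *m P).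
  have -> : (1%:M - L)^T = 1%:M - L^T by rewrite linearB/= trmx1.
  rewrite !mulmxBl !mulmxBr !mulmxBl !mul1mx !mulmx1.
  rewrite !raddfB/= (mxtrace_mulC (L *m P)) mulmxA.
  have -> : \tr (L^T *m P) = \tr (L *m P).
    by rewrite -mxtrace_tr trmx_mul trmxK (posdefmx_sym pP) mxtrace_mulC.
  by ring.
move=> <-; apply: eq_integral => t _; congr EFin.
rewrite sqdistE /= vec_affine.
have -> : vec t - (L *m vec t + b) = (1%:M - L) *m (vec t - u) + w.
  rewrite wE mulmxBl mul1mx mulmxBr; move: (L *m vec t) (L *m u) => x y.
  by apply/colP => i; rewrite !mxE; ring.
move: (vec t - u) => x.
move: (1%:M - L) => N.
rewrite qformE -mulmxA (dotMr N^T) trmxK dotZl (dotMl N^T) trmxK !dotDl !dotDr.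
by rewrite (dotC w); ring.
Qed.

Lemma W2sq_sym p q : W2sq p q = W2sq q p.
Proof.
suff le (p1 q1 : probability E R) : (W2sq q1 p1 <= W2sq p1 q1)%E.
  by apply/eqP; rewrite eq_le !le.
apply: le_ereal_inf_tmp => _ [g gpq <-].
pose sw (x : E * E) := (x.2, x.1).
have msw : measurable_fun setT sw by exact: measurable_fun_pair.
pose X : {mfun (E * E)%type >-> (E * E)%type} :=
  HB.pack sw (isMeasurableFun.Build _ _ _ _ _ msw).
apply: ereal_inf_lbound; exists (distribution g X).
  by move=> A mA; have [] := gpq A mA.
rewrite /distribution (ge0_integral_pushforward msw)//=; last 2 first.
- by apply/measurable_EFinP; exact: measurable_sqdist.
- by move=> x _; rewrite lee_fin sqdist_ge0.
apply: eq_integral => x _; congr EFin; rewrite /= /sqdist.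
by apply: eq_bigr => i _; rewrite -sqrrN opprB.
Qed.

(** Reduces variations of the first marginal to variations of the second. *)
Lemma objective_sym tau0 tau1 mu nu p q :
  objective tau0 tau1 mu nu p q = objective tau1 tau0 nu mu q p.
Proof. by rewrite /objective W2sq_sym addeAC. Qed.

Lemma minimizer_le tau0 tau1 mu nu p q : minimizer tau0 tau1 mu nu p q ->
  forall p1 q1,
    (objective tau0 tau1 mu nu p q <= objective tau0 tau1 mu nu p1 q1)%E.
Proof.
by move=> -> p1 q1; apply: ereal_inf_lbound; exists p1 => //; exists q1.
Qed.

End Wasserstein.

(** * First variation at a minimizer and the resulting eigenvalue bound *)

Section Stationarity.
Variables (R : realType) (d : nat).
Local Notation E := (Rspace R d).
Implicit Types (p q mu nu : probability E R) (P Q L M S : 'M[R]_d).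

Lemma slope_ge0 (a b : R) :
  (forall t, 0 < t -> 0 <= t * a + t ^+ 2 * b) -> 0 <= a.
Proof.
move=> H; rewrite leNgt; apply/negP => a0.
pose t := - a / (1 + `|b|).
have b1 : 0 < 1 + `|b| by rewrite ltr_pwDl.
have t0 : 0 < t by rewrite divr_gt0// oppr_gt0.
have := H t t0.
have tb : t * (1 + `|b|) = - a by rewrite /t divfK// gt_eqF.
have : b <= `|b| by exact: ler_norm.
by nra.
Qed.

(** Apply ln x <= x - 1 to the inverse of 1 + t; the quadratic error disappears in the first
    variation. *)
Lemma ln1D_ge (t : R) : 0 < t -> t - t ^+ 2 <= ln (1 + t).
Proof.
move=> t0; have t1 : 0 < 1 + t by lra.
have := @le_ln1Dx R ((1 + t)^-1 - 1).
rewrite (addrC 1 (_ - 1)) subrK lnV ?posrE// => H.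
have {H} := H _; rewrite ltrBrDl subrr invr_gt0 => /(_ t1).
have tt : (1 + t) * (1 + t)^-1 = 1 by rewrite mulfV// gt_eqF.
have i0 : 0 < (1 + t)^-1 by rewrite invr_gt0.
nra.
Qed.

Lemma mxtrace_mul_outer (A : 'M[R]_d) (x : 'cV[R]_d) :
  \tr (A *m (x *m x^T)) = qform A x.
Proof.
by rewrite mulmxA mxtrace_mulC qformE /dot /mxtrace big_ord_recl big_ord0 addr0.
Qed.

(** Only real bounds are known for the transport costs [V] and [W]; [b] stands for the entropy of
    the unchanged marginal. *)
Lemma ereal_le_cancel_common (lo up b c e : R) (V W : \bar R) :
  (lo%:E <= V)%E -> (W <= up%:E)%E ->
  (V + b%:E + c%:E <= W + b%:E + e%:E)%E -> lo + c <= up + e.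
Proof.
move=> loV Wup VW; rewrite -(lerD2r b) -!addrA ![_ + b]addrC !addrA.
rewrite -lee_fin !EFinD; apply: (le_trans _ (le_trans VW _)).
  by rewrite -!addeA; exact: leeD2r.
by rewrite -!addeA; exact: leeD2r.
Qed.

(* First variation of the objective when the second marginal is stretched by
   1 + t along an eigenvector of its covariance, the coupling being carried
   along the optimal transport map. *)
Lemma minimizer_first_variation tau0 tau1 mu nu p q m0 S0 m S u P v Q M
    (x : 'cV[R]_d) a :
  0 < tau0 -> 0 < tau1 ->
  nondegenerate_gaussian mu m0 S0 -> nondegenerate_gaussian nu m S ->
  nondegenerate_gaussian p u P -> nondegenerate_gaussian q v Q ->
  (forall q1,
    (objective tau0 tau1 mu nu p q <= objective tau0 tau1 mu nu p q1)%E) ->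
  posdefmx M -> M *m P *m M = Q -> dot x x = 1 -> Q *m x = a *: x ->
  0 <= 2 * a * (1 - qform (invmx M) x) + tau1 * (a * qform (invmx S) x - 1).
Proof.
move=> tau0_gt0 tau1_gt0 gmu gnu gp gq pqmin pM MPM xx Qx.
have uM := posdefmx_unit pM; have symM := posdefmx_sym pM.
have pQ := gq.1; have symQ := posdefmx_sym pQ.
(* The second-order coefficient collects the t^2 terms of the transport bound, of the entropy trace
   and of the lower bound on ln (1 + t). *)
apply: (@slope_ge0 _ (a + tau1 * a * qform (invmx S) x / 2 + tau1)) => t t0.
pose X := x *m x^T.
have symX : X^T = X by rewrite trmx_mul trmxK.
pose G := 1%:M + t *: X.
have symG : G^T = G by rewrite linearD/= linearZ/= trmx1 symX.
have detG : \det G = 1 + t.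
  by rewrite /G scalemxAl det_rank1_update dotZr xx mulr1.
have t1 : 0 < 1 + t by lra.
have uG : G \in unitmx by rewrite unitmxE unitfE detG gt_eqF.
have QX : Q *m X = a *: X by rewrite mulmxA Qx -scalemxAl.
have XQ : X *m Q = a *: X.
  by rewrite -[LHS]trmxK trmx_mul symQ symX QX linearZ/= symX.
have XX : X *m X = X by rewrite mulmxA outer_mul xx scale1r.
have GQG : G *m Q *m G = Q + ((2 * t + t ^+ 2) * a) *: X.
  have -> : G *m Q = Q + (t * a) *: X.
    by rewrite /G mulmxDl mul1mx -scalemxAl XQ scalerA.
  rewrite mulmxDr mulmx1 -scalemxAr mulmxDl QX -scalemxAl XX.
  rewrite scalerDr !scalerA -addrA -2!scalerDl; congr (_ + _ *: _).
  by ring.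
pose L := G *m M.
have uL : L \in unitmx by rewrite unitmx_mul uG uM.
have LPL : L *m P *m L^T = G *m Q *m G.
  by rewrite /L trmx_mul symM symG -MPM !mulmxA.
(* The mean stays at [v], so the mean terms cancel in both transport and entropy. *)
pose b := v - L *m u.
have Lub : L *m u + b = v by rewrite addrC subrK.
have [q1 [gq1 q1p]] := gaussian_affine b gp.1 gp.2 uL.
rewrite LPL Lub in gq1.
have := pqmin q1.
rewrite /objective (KL_gaussian gp gmu) (KL_gaussian gq gnu).
rewrite (KL_gaussian gq1 gnu).
set k0 := gaussian_KL _ _ m0 _; set k := gaussian_KL _ _ m S.
set k1 := gaussian_KL _ _ m S.
have := W2sq_ge gp gq pM MPM.
have := W2sq_le gp q1p (congr1 (fun z => u - z) (esym Lub)).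
rewrite LPL; set up := (X in (_ <= X%:E)%E -> _).
set lo := (X in (X%:E <= _)%E -> _).
move=> le_up lo_le obj_le.
have := ereal_le_cancel_common lo_le le_up obj_le.
have trX : \tr X = 1.
  by have := mxtrace_mul_outer 1%:M x; rewrite mul1mx qformE mul1mx xx.
(* From M P = Q M^-1 and Q x = a x. *)
have trMPX : \tr (X *m (M *m P)) = a * qform (invmx M) x.
  rewrite mxtrace_mulC mxtrace_mul_outer.
  have -> : M *m P = Q *m invmx M by rewrite -MPM mulmxK.
  by rewrite !qformE -mulmxA (dotMr Q) symQ Qx dotZl.
have upE : up = lo + (2 * t + t ^+ 2) * a - 2 * t * (a * qform (invmx M) x).
  have trGMP : \tr (L *m P) = \tr (M *m P) + t * (a * qform (invmx M) x).
    by rewrite /L -mulmxA mulmxDl mul1mx -scalemxAl mxtraceD mxtraceZ trMPX.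
  by rewrite /up /lo GQG trGMP mxtraceD mxtraceZ trX; ring.
have k1E : k1 = k + (2 * t + t ^+ 2) * a * qform (invmx S) x / 2 - ln (1 + t).
  rewrite /k1 /k /gaussian_KL !det_mulmx detG.
  rewrite lnM ?posrE ?mulr_gt0 ?posdefmx_det// lnM ?posrE ?posdefmx_det//.
  rewrite GQG mulmxDr mxtraceD -scalemxAr mxtraceZ mxtrace_mul_outer.
  by field.
rewrite upE k1E; have := ln1D_ge t0.
move: (ln _) (qform _ _) (qform _ _) => l s n lnt H.
have : tau1 * (t - t ^+ 2) <= tau1 * l by rewrite ler_pM2l.
by nra.
Qed.

(** For y = A^-1 x and l the least eigenvalue, combine l |y|^2 <= x.y with |x - l y|^2 >= 0. *)
Lemma qform_invmx_le (A : 'M[R]_d) (x : 'cV[R]_d) : (0 < d)%N -> posdefmx A ->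
  dot x x = 1 -> lambda_min A * qform (invmx A) x <= 1.
Proof.
move=> d0 pA xx; have l0 := lambda_min_gt0 d0 pA.
have [_ [_ _ /(_ (invmx A *m x))]] := lambda_min_spec d0 (posdefmx_sym pA).
rewrite !qformE mulKVmx ?posdefmx_unit//.
have := dot_ge0 (x - lambda_min A *: (invmx A *m x)).
rewrite !dotDl !dotDr !dotNl !dotNr !dotZl !dotZr xx (dotC (invmx A *m x) x).
move: (lambda_min A) l0 (dot x _) (dot (invmx A *m x) _) => l l0 k y H1 H2.
by nra.
Qed.

(* This is (1 / l + 2 / tau)^-1: stationarity reads
   P^-1 = S0^-1 + (2 / tau) (1 - M), whence P^-1 <= 1 / l + 2 / tau. *)
Definition covariance_floor (tau l : R) := tau * l / (2 * l + tau).

Lemma covariance_floor_gt0 tau l :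
  0 < tau -> 0 < l -> 0 < covariance_floor tau l.
Proof. by move=> tau0 l0; rewrite divr_gt0 ?mulr_gt0 ?addr_gt0 ?mulr_gt0. Qed.

Lemma minimizer_lambda_min tau0 tau1 mu nu p q m0 S0 m S u P v Q :
  (0 < d)%N -> 0 < tau0 -> 0 < tau1 ->
  nondegenerate_gaussian mu m0 S0 -> nondegenerate_gaussian nu m S ->
  nondegenerate_gaussian p u P -> nondegenerate_gaussian q v Q ->
  minimizer tau0 tau1 mu nu p q ->
  Num.min (lambda_min S) (covariance_floor tau0 (lambda_min S0))
    <= lambda_min Q.
Proof.
move=> d0 tau0_gt0 tau1_gt0 gmu gnu gp gq pqmin.
have [M [pM MPM MQ]] := transport_matrix gp.1 gq.1.
have uM := posdefmx_unit pM.
have l0 := lambda_min_gt0 d0 gmu.1; set l := lambda_min S0 in l0 *.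
set c := covariance_floor tau0 l.
have c0 : 0 < c by exact: covariance_floor_gt0.
have cP : c <= lambda_min P.
  have [x [xx Px _]] := lambda_min_spec d0 (posdefmx_sym gp.1).
  have IMQ : invmx M *m Q *m invmx M = P.
    by rewrite -MPM !mulmxA mulVmx// mul1mx mulmxK.
  (* Exchanging the marginals turns M into M^-1, so the first variation applies to [P]; its term in
     x.M x has a favourable sign and is dropped. *)
  have qpmin p1 :
      (objective tau1 tau0 nu mu q p <= objective tau1 tau0 nu mu q p1)%E.
    by rewrite !(objective_sym tau1); exact: minimizer_le.
  have := minimizer_first_variation tau1_gt0 tau0_gt0 gnu gmu gq gp qpmin
    (posdefmx_inv pM) IMQ xx Px.
  rewrite invmxK; have := posdefmx_qform_ge0 x pM.
  have := qform_invmx_le d0 gmu.1 xx; rewrite -/l.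
  have := lambda_min_gt0 d0 gp.1.
  rewrite /c /covariance_floor ler_pdivrMr; last first.
    by rewrite addr_gt0 ?mulr_gt0.
  move: (lambda_min P) (qform _ _) (qform _ _) => e n s e0 ls n0 H.
  have H2 : 0 <= 2 * e + tau0 * e * s - tau0 by nra.
  have := mulr_ge0 (ltW l0) H2.
  have : 0 <= tau0 * e * (1 - l * s).
    by rewrite mulr_ge0 ?subr_ge0 ?mulr_ge0// ltW.
  by nra.
have [x [xx Qx _]] := lambda_min_spec d0 (posdefmx_sym gq.1).
have e0 := lambda_min_gt0 d0 gq.1.
have Pc (y : 'cV[R]_d) : c * dot y y <= qform P y.
  have [_ [_ _ /(_ y)]] := lambda_min_spec d0 (posdefmx_sym gp.1).
  by apply: le_trans; rewrite ler_wpM2r// dot_ge0.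
have := MQ c _ x (ltW c0) e0 Pc Qx xx.
have := minimizer_first_variation tau0_gt0 tau1_gt0 gmu gnu gp gq
  (minimizer_le pqmin p) pM MPM xx Qx.
have := qform_invmx_le d0 gnu.1 xx.
have := lambda_min_gt0 d0 gnu.1.
move: (lambda_min S) (lambda_min Q) e0 (qform _ _) (qform _ _) {Qx}.
move=> f e e0 n s f0 fs H cn.
rewrite leNgt; apply/negP; rewrite lt_min => /andP[ef ec].
have se : Num.sqrt e ^+ 2 = e by rewrite sqr_sqrtr// ltW.
have sec : Num.sqrt e < Num.sqrt c by rewrite ltr_sqrt.
have se0 : 0 < Num.sqrt e by rewrite sqrtr_gt0.
(* Both summands of the first variation become negative: sqrt c sqrt e <= e n with e < c for the
   transport part, and e < f with f s <= 1 for the entropy part. *)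
have en : e < e * n by nra.
have es : e * s < 1 by have [s0|s0] := lerP s 0; nra.
have : 0 < tau1 * (1 - e * s) by rewrite mulr_gt0// subr_gt0.
by nra.
Qed.

End Stationarity.

Lemma posdefmx_of_lambda_min (R : realType) d (A : 'M[R]_d) :
  (0 < d)%N -> A^T = A -> 0 < lambda_min A -> posdefmx A.
Proof.
move=> d0 symA l0; have [_ [_ _ Ax]] := lambda_min_spec d0 symA.
split=> [|x x0]; first exact/symmetricmxP.
by apply: lt_le_trans (Ax x); rewrite mulr_gt0// dot_gt0.
Qed.

(** * Mixtures of covariances and their weights *)

Section Mixture.
Variables (R : realType) (d n : nat).
Hypothesis d0 : (0 < d)%N.

Lemma mixture_covariance_sym (w : 'I_n -> R) (Q : 'I_n -> 'M[R]_d)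
    (z : 'I_n -> 'cV[R]_d) :
  (forall i, (Q i)^T = Q i) ->
  (\sum_i w i *: (Q i + z i *m (z i)^T))^T =
  \sum_i w i *: (Q i + z i *m (z i)^T).
Proof.
move=> symQ; rewrite linear_sum; apply: eq_bigr => i _.
by rewrite linearZ/= linearD/= symQ trmx_mul trmxK.
Qed.

Lemma mixture_lambda_min (w : 'I_n -> R) (Q : 'I_n -> 'M[R]_d)
    (z : 'I_n -> 'cV[R]_d) c :
  (forall i, 0 <= w i) -> \sum_i w i = 1 -> (forall i, (Q i)^T = Q i) ->
  (forall i, c <= lambda_min (Q i)) ->
  c <= lambda_min (\sum_i w i *: (Q i + z i *m (z i)^T)).
Proof.
move=> w0 w1 symQ cQ; apply: lambda_min_ge => // [|x xx].
  exact: mixture_covariance_sym.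
rewrite qformE mulmx_suml /dot mulmx_sumr summxE -[c]mul1r -w1 mulr_suml.
apply: ler_sum => i _; rewrite -/(dot _ _) -scalemxAl dotZr ler_wpM2l//.
rewrite mulmxDl dotDr outer_mul dotZr (dotC x (z i)) -expr2 -qformE.
have [_ [_ _ /(_ x)]] := lambda_min_spec d0 (symQ i).
rewrite xx mulr1 => Qx; apply: (le_trans (cQ i)); apply: (le_trans Qx).
by rewrite lerDl sqr_ge0.
Qed.

End Mixture.

Section Weights.
Variables (R : realType) (d n : nat) (tau0 tau1 : R) (lam a : 'I_n -> R).
Variable mu : 'I_n -> probability (Rspace R d) R.
Hypotheses (n0 : (0 < n)%N) (lam0 : forall i, 0 < lam i).
Hypothesis a0 : forall i, 0 < a i.

Let w (nu : probability (Rspace R d) R) j :=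
  lam j * a j `^ (tau0 / (tau0 + tau1)) *
  expR (- (fine (Acost tau0 tau1 (mu j) nu) / (tau0 + tau1))).

Let w_gt0 nu j : 0 < w nu j.
Proof. by rewrite !mulr_gt0 ?expR_gt0 ?powR_gt0. Qed.

Let sum_w_gt0 nu : 0 < \sum_j w nu j.
Proof.
rewrite (bigD1 (Ordinal n0))//= ltr_pwDl// sumr_ge0// => i _.
exact: ltW.
Qed.

Lemma weight_ge0 nu i : 0 <= weight tau0 tau1 lam a mu nu i.
Proof. by rewrite ltW// divr_gt0//; [exact: w_gt0|exact: sum_w_gt0]. Qed.

Lemma sum_weight nu : \sum_i weight tau0 tau1 lam a mu nu i = 1.
Proof. by rewrite -mulr_suml divff// gt_eqF//; exact: sum_w_gt0. Qed.

End Weights.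

(** * The bound along the orbit *)

Unset Implicit Arguments.

Theorem corollary5p7 (R : realType) (d n : nat) (tau0 tau1 : R)
    (lam a : 'I_n -> R) (mu : 'I_n -> probability (Rspace R d) R)
    (mean : 'I_n -> 'cV[R]_d) (cov : 'I_n -> 'M[R]_d)
    (m0 : 'cV[R]_d) (S0 : 'M[R]_d) :
  (0 < d)%N -> (0 < n)%N -> 0 < tau0 -> 0 < tau1 ->
  (forall i, 0 < lam i) -> \sum_i lam i = 1 -> (forall i, 0 < a i) ->
  (forall i, nondegenerate_gaussian (mu i) (mean i) (cov i)) ->
  posdefmx S0 ->
  exists sigma_orb p_orb : R,
    [/\ 0 < p_orb, sigma_orb = Num.min (lambda_min S0) p_orb, 0 < sigma_orb
      & forall (nu : nat -> probability (Rspace R d) R)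
          (m : nat -> 'cV[R]_d) (S : nat -> 'M[R]_d),
        moment_orbit tau0 tau1 lam a mu m0 S0 nu m S ->
        (forall k, Num.min (lambda_min (S k)) p_orb <= lambda_min (S k.+1)) /\
        (forall k, loewner_le sigma_orb%:M (S k))].
Proof.
move=> d0 n0 tau0_gt0 tau1_gt0 lam0 _ a0 gmu pS0.
pose c i := covariance_floor tau0 (lambda_min (cov i)).
have c0 i : 0 < c i.
  by apply: covariance_floor_gt0 => //; exact: lambda_min_gt0 (gmu i).1.
(* The least floor over the components depends only on [tau0] and the covariances of the [mu i], not
   on the orbit; the default value 1 keeps it positive. *)
pose p := \big[Num.min/1]_i c i.
have p0 : 0 < p.
  by apply/bigmin_gtP; split=> // i _; exact: c0.
have sigma0 : 0 < Num.min (lambda_min S0) p by rewrite lt_min lambda_min_gt0.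
exists (Num.min (lambda_min S0) p), p; split=> // nu m S [m0E S0E law upd].
(* Positive definiteness is propagated together with the bound, since [gaussian_law] alone does not
   include it and the minimizer estimate requires it of [S k]. *)
have step k : posdefmx (S k) ->
    Num.min (lambda_min (S k)) p <= lambda_min (S k.+1) /\ posdefmx (S k.+1).
  move=> pSk.
  have [P [Q [u [v [V [W [pqmin gP gQ mE SE]]]]]]] := upd k.
  have symW i : (W i)^T = W i := posdefmx_sym (gQ i).1.
  have le_next : Num.min (lambda_min (S k)) p <= lambda_min (S k.+1).
    rewrite SE; apply: mixture_lambda_min => // [i||i].
    - exact: weight_ge0.
    - exact: sum_weight.
    have gnu : nondegenerate_gaussian (nu k) (m k) (S k) by split.
    have := minimizer_lambda_min d0 tau0_gt0 tau1_gt0 (gmu i) gnu (gP i) (gQ i)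
      (pqmin i).
    by apply: le_trans; rewrite le_min ge_min lexx ge_min bigmin_le orbT.
  split=> //; apply: posdefmx_of_lambda_min => //.
    by rewrite SE mixture_covariance_sym.
  by apply: lt_le_trans le_next; rewrite lt_min lambda_min_gt0.
have pS k : posdefmx (S k).
  by elim: k => [|k /step[]//]; rewrite S0E.
have le_next k := (step k (pS k)).1.
split=> // k.
have sigma_le : Num.min (lambda_min S0) p <= lambda_min (S k).
  elim: k => [|k IHk]; first by rewrite S0E ge_min lexx.
  by apply: le_trans (le_next k); rewrite le_min IHk ge_min lexx orbT.
split=> [|x].
  by apply/symmetricmxP; rewrite linearB/= (posdefmx_sym (pS k)) tr_scalar_mx.
have [_ [_ _ /(_ x) Sx]] := lambda_min_spec d0 (posdefmx_sym (pS k)).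
rewrite qformE mulmxBl dotDr dotNr mul_scalar_mx dotZr -qformE subr_ge0.
by apply: le_trans Sx; rewrite ler_wpM2r// dot_ge0.
Qed.
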